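(* Under the Levi-Civita transformations $q_i(t)=z_i(\tau_i(t))^2$ ($i=1,2$) with time changes $\tau_i$ satisfying $\tau_i(0)=0$ and $\frac{dt}{q_i(t)}=\frac{d\tau_i(t)}{\|z_i\|^2}$, critical points $(z_1,z_2)$ of the action functional $\mathscr{B}_{av}$ are in 4-to-1 correspondence with generalized solutions $(q_1,q_2)$ of the system $$\ddot q_1=-\frac{2}{(q_1)^2}+\frac{1}{(\bar q_1+\bar q_2)^2},\qquad \ddot q_2=-\frac{2}{(q_2)^2}+\frac{1}{(\bar q_1+\bar q_2)^2}.$$ That is, the assignment $(z_1,z_2)\mapsto(q_1,q_2)$ maps the set of critical points of $\mathscr{B}_{av}$ onto the set of generalized solutions, and every generalized solution has exactly four preimages.
   Context: $S^1=\mathbb{R}/\mathbb{Z}$; $\langle u,v\rangle=\int_0^1 u(\tau)v(\tau)\,d\tau$ and $\|u\|=\sqrt{\langle u,u\rangle}$ are the $L^2$-inner product and norm; $z_i^2$ denotes the pointwise square, so $\|z_i^2\|^2=\int_0^1 z_i^4\,d\tau$; $z_i'$ is the derivative in $\tau$, and $\dot q_i$ the derivative in $t$; $\bar q_i=\int_0^1 q_i(t)\,dt$. Functional. Let $\tilde{\mathscr{H}}^1_{av}=\{z=(z_1,z_2)\in H^1(S^1,\mathbb{R}^2): \|z_1\|>0,\ \|z_2\|>0\}$. The functional is $$\mathscr{B}_{av}(z_1,z_2)=\sum_{i=1}^2\left(2\|z_i\|^2\|z_i'\|^2+\frac{2}{\|z_i\|^2}\right)-\frac{\|z_1\|^2\|z_2\|^2}{\|z_1^2\|^2\|z_2\|^2+\|z_2^2\|^2\|z_1\|^2}.$$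 It is invariant under the torus action of $\mathbb{T}^2=S^1\times S^1$ on $\tilde{\mathscr{H}}^1_{av}$ by independent time shifts $(z_1(\cdot),z_2(\cdot))\mapsto(z_1(\cdot+\theta_1),z_2(\cdot+\theta_2))$, hence also defines a functional on $\mathscr{H}^1_{av}=\tilde{\mathscr{H}}^1_{av}/\mathbb{T}^2$. In this statement a critical point $(z_1,z_2)$ is an actual pair of functions in $\tilde{\mathscr{H}}^1_{av}$ at which the differential of the functional $\mathscr{B}_{av}$, regarded as a functional on $\tilde{\mathscr{H}}^1_{av}$, vanishes. Levi-Civita transformation. For a continuous $z:S^1\to\mathbb{R}$ with finitely many zeros, $t_z(\tau)=\frac{1}{\|z\|^2}\int_0^\tau z(s)^2\,ds$ defines a homeomorphism $t_z:S^1\to S^1$; with $\tau_z=t_z^{-1}$, the associated $q:S^1\to\mathbb{R}_{\ge0}$ is $q(t)=z(\tau_z(t))^2$. The time changes $\tau_i$ in the Levi-Civita transformations $q_i(t)=z_i(\tau_i(t))^2$, satisfying $\tau_i(0)=0$ and $\frac{dt}{q_i(t)}=\frac{d\tau_i(t)}{\|z_i\|^2}$, are $\tau_i=\tau_{z_i}$. Generalized solution. A pair $(q_1,q_2)\in H^1(S^1,\mathbb{R}_{\ge0}\times\mathbb{R}_{\ge0})$ is called a generalized solution of the system if for $i=1,2$: (1) the zero set $Z_i=q_i^{-1}(0)\subset S^1$ is finite and has an even number of elements; (2) the restriction $q_i|_{S^1\setminus Z_i}$ is smooth and satisfies the system; (3) the energy $E_i(t)=\frac{\dot q_i(t)^2}{2}-\frac{2}{q_i(t)}-\frac{q_i(t)}{(\bar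 q_1+\bar q_2)^2}$, $t\in S^1\setminus Z_i$, extends to a continuous function $S^1\to\mathbb{R}$. *)

(* Defs.v *)
From mathcomp Require Import all_boot all_order all_algebra.
From mathcomp Require Import all_classical all_reals all_analysis.
Import Order.TTheory GRing.Theory Num.Theory.
Import numFieldNormedType.Exports.

Set Implicit Arguments.
Unset Strict Implicit.
Unset Printing Implicit Defensive.

Local Open Scope classical_set_scope.
Local Open Scope card_scope.
Local Open Scope ring_scope.

(** Functions on [S^1 = R/Z] are 1-periodic functions on [R]; points of [S^1]
    are represented by the elements of [[0, 1[]]. *)

Section Circle.
Context {R : realType}.
Implicit Types (u v z q : R -> R).

Local Notation leb := (@lebesgue_measure R).

Definition mean u : R := \int[leb]_(t in `[0, 1]) u t.

Definition dot u v : R := mean (fun t => u t * v t).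

Definition norm2 u : R := Num.sqrt (dot u u).

(** The zero set of [u] on the circle. *)
Definition zeros u : set R := [set t | 0 <= t < 1 /\ u t = 0].

(** The signed integral from [a] to [b], for [a] and [b] in either order. *)
Definition sint (a b : R) u : R :=
  \int[leb]_(t in `[a, b]) u t - \int[leb]_(t in `[b, a]) u t.

Definition L2_circle v : Prop :=
  [/\ periodic v 1, measurable_fun setT v &
      leb.-integrable `[0, 1] (fun t => (v t ^+ 2)%:E)].

(** [v] is a weak derivative, of class L^2, of the absolutely continuous
    function [z]. *)
Definition is_weak_derivative z v : Prop :=
  L2_circle v /\ forall a b, z b - z a = sint a b v.

(** H^1(S^1): every class is represented by its unique absolutely continuous
    representative. *)
Definition H1 : set (R -> R) :=
  [set z | periodic z 1 /\ exists v, is_weak_derivative z v].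

(** The weak derivative, unique only up to a null set; it is used only inside
    integrals. *)
Definition wderiv z : R -> R := xget (fun=> 0) (is_weak_derivative z).

(** Meaningful when [z] is continuous with finitely many zeros on the circle:
    [time_change z] is then the lift to [R], fixing 0, of the homeomorphism t_z
    of the circle, and [time_change_inv z] is the lift of its inverse. *)
Definition time_change z (tau : R) : R :=
  sint 0 tau (fun s => z s ^+ 2) / norm2 z ^+ 2.

Definition time_change_inv z : R -> R := pinv setT (time_change z).

Definition levi_civita1 z : R -> R := fun t => z (time_change_inv z t) ^+ 2.

End Circle.

Section Helium.
Context {R : realType}.

Definition pair_fun : Type := ((R -> R) * (R -> R))%type.

Implicit Types (z h q : pair_fun).

Definition H1pair : set pair_fun := [set z | H1 z.1 /\ H1 z.2].

Definition H1norm z : R :=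
  Num.sqrt (norm2 z.1 ^+ 2 + norm2 (wderiv z.1) ^+ 2 +
            norm2 z.2 ^+ 2 + norm2 (wderiv z.2) ^+ 2).

(** The open subset of H^1(S^1, R^2) on which the functional is defined. *)
Definition H1av : set pair_fun :=
  [set z | [/\ H1pair z, 0 < norm2 z.1 & 0 < norm2 z.2]].

Definition Bav z : R :=
  let sq u := fun t : R => u t ^+ 2 : R in
  let kin u := 2 * norm2 u ^+ 2 * norm2 (wderiv u) ^+ 2 + 2 / norm2 u ^+ 2 in
  kin z.1 + kin z.2
  - norm2 z.1 ^+ 2 * norm2 z.2 ^+ 2
    / (norm2 (sq z.1) ^+ 2 * norm2 z.2 ^+ 2
       + norm2 (sq z.2) ^+ 2 * norm2 z.1 ^+ 2).

(** [L] (assumed bounded and linear) is the Frechet differential of [F] at [z]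
    with respect to the H^1 norm. *)
Definition has_differential (F : pair_fun -> R) z (L : pair_fun -> R) : Prop :=
  forall e : R, 0 < e -> exists2 d : R, 0 < d &
    forall h, H1pair h -> H1av (z.1 \+ h.1, z.2 \+ h.2) -> H1norm h < d ->
      `|F (z.1 \+ h.1, z.2 \+ h.2) - F z - L h| <= e * H1norm h.

Definition critical_points : set pair_fun :=
  [set z | H1av z /\ has_differential Bav z (fun=> 0)].

Definition levi_civita z : pair_fun := (levi_civita1 z.1, levi_civita1 z.2).

(** Smoothness of [q] and the equation of motion off the zero set, where [c]
    stands for the sum of the two mean values. *)
Definition solves_off_zeros (c : R) (q : R -> R) : Prop :=
  (forall n t, q t != 0 -> derivable (derive1n n q) t 1) /\
  (forall t, q t != 0 -> derive1n 2 q t = - (2 / q t ^+ 2) + 1 / c ^+ 2).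

Definition energy (c : R) (q : R -> R) (t : R) : R :=
  derive1 q t ^+ 2 / 2 - 2 / q t - q t / c ^+ 2.

Definition energy_extends (c : R) (q : R -> R) : Prop :=
  exists E : R -> R, [/\ periodic E 1, continuous E &
    forall t, q t != 0 -> E t = energy c q t].

Definition generalized_solution1 (c : R) (q : R -> R) : Prop :=
  [/\ H1 q, forall t, 0 <= q t, exists n, zeros q #= `I_n.*2,
      solves_off_zeros c q & energy_extends c q].

Definition generalized_solutions : set pair_fun :=
  [set q | let c := mean q.1 + mean q.2 in
           generalized_solution1 c q.1 /\ generalized_solution1 c q.2].

End Helium.

Arguments pair_fun : clear implicits.

(* Main.v *)
(** The differential of [Bav] at [z] is computed by expanding the mass
    [|z_i|^2], the kinetic term [|z_i'|^2] and the quartic term [|z_i^2|^2] to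
    first order.  With [c = sum_i |z_i^2|^2 / |z_i|^2], a du Bois-Reymond argument
    turns its vanishing into [z_i'' = A_i z_i + z_i^3 / (|z_i|^4 c^2)], where the
    value of [A_i] amounts to the first integral
    [z_i'^2 = A_i z_i^2 + z_i^4 / (2 |z_i|^4 c^2) + 1 / |z_i|^4].  In particular
    the zeros of [z_i] are simple, hence finite in number, and even in number by
    periodicity; in the time [t] the first integral is the conservation of the
    energy of [q_i], and [c] is the sum of the two mean values.

    Conversely [(q q')' = 2 / q + 2 e + 3 q / c^2] for a generalized solution of
    energy [e], and [q q'] extends continuously by 0 to the collisions; so [1 / q]
    is integrable and [tau(t) = a * int_0^t 1 / q] inverts the time change.  The
    function [y = q o tau^-1] is of class C^2 and [z] is its square root, with a
    sign that changes at each zero.  Both the parity of the number of zeros and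
    the uniqueness of [z] up to sign follow from the fact that a function of even
    order at each of its zeros has constant sign. *)

Require Import Defs.
From HB Require Import structures.
From mathcomp Require Import all_boot all_order all_algebra.
From mathcomp Require Import all_classical all_reals all_analysis.
From mathcomp Require Import measurable_realfun zify ring lra.
Import Order.TTheory GRing.Theory Num.Theory.
Import numFieldNormedType.Exports.

Set Implicit Arguments.
Unset Strict Implicit.
Unset Printing Implicit Defensive.

Local Open Scope classical_set_scope.
Local Open Scope card_scope.
Local Open Scope ring_scope.

(** * Signed integrals of locally integrable functions *)

Section SignedIntegral.
Context {R : realType}.
Implicit Types (f g u v : R -> R) (a b c x y : R).
Local Notation mu := (@lebesgue_measure R).

(** The obstacle is the collisions: [q_i'] and [1 / q_i] are unbounded there, so every identity in
    the time [t] holds only off isolated points. The calculus is therefore built for continuous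
    functions that are differentiable off such points. They are determined by their derivative up to
    a constant, and a nonnegative derivative is automatically integrable. This is what makes the
    energy one constant on the whole circle instead of one per arc between collisions. The two
    components interact only through the number [c]. With [c] fixed the problem splits into two
    scalar ones, and [c] is recovered afterwards from the solutions. The value of [A_i] and the
    constant of the first integral determine each other by averaging the first integral over a
    period; the constant [1 / |z_i|^4] is what becomes the attraction [- 2 / q_i^2]. The number four
    counts two independent signs: [q_i] determines the inverse time change, hence [z_i^2], hence
    [z_i] up to sign. *)

Definition loc_int f := forall a b, mu.-integrable `[a, b] (EFin \o f).

Lemma loc_int_continuous f : continuous f -> loc_int f.
Proof.
move=> cf a b; apply: continuous_compact_integrable; first exact: segment_compact.
exact: continuous_subspaceT.
Qed.

Lemma loc_intD f g : loc_int f -> loc_int g -> loc_int (fun x => f x + g x).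
Proof. by move=> fi gi a b; apply: (integrableD _ (fi a b) (gi a b)). Qed.

Lemma loc_intZ k f : loc_int f -> loc_int (fun x => k * f x).
Proof. by move=> fi a b; apply: (integrableZl _ k (fi a b)). Qed.

Lemma loc_intN f : loc_int f -> loc_int (fun x => - f x).
Proof. by move=> fi a b; apply: (integrableN (fi a b)). Qed.

Lemma loc_intB f g : loc_int f -> loc_int g -> loc_int (fun x => f x - g x).
Proof. by move=> fi gi; apply: loc_intD => //; exact: loc_intN. Qed.

Lemma loc_int_norm f : loc_int f -> loc_int (fun x => `|f x|).
Proof. by move=> fi a b; exact: (integrable_norm (fi a b)). Qed.

Lemma sint_le a b f : a <= b -> sint a b f = \int[mu]_(t in `[a, b]) f t.
Proof.
rewrite /sint le_eqVlt => /predU1P[->|ab]; first by rewrite set_itv1 Rintegral_set1 subr0.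
by rewrite (@set_itv_ge _ _ (BLeft b)) ?bnd_simp -?ltNge// Rintegral_set0 subr0.
Qed.

Lemma sintC a b f : sint b a f = - sint a b f.
Proof. by rewrite /sint opprB. Qed.

Lemma sintxx a f : sint a a f = 0.
Proof. by rewrite /sint subrr. Qed.

Lemma mean_sint f : mean f = sint 0 1 f.
Proof. by rewrite sint_le. Qed.

Let sint_chasles_le a b c f : loc_int f -> a <= b -> b <= c ->
  sint a b f + sint b c f = sint a c f.
Proof.
move=> fi ab bc; rewrite !sint_le//; last exact: le_trans bc.
have := @Rintegral_itvB R f (BLeft a) (BRight c) b (fi _ _).
rewrite !bnd_simp => /(_ ab bc) => E.
rewrite -[X in X = _]subr0 -[RHS]subr0.
have -> : \int[mu]_(t in `[b, c]) f t = \int[mu]_(t in `]b, c]) f t.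
  apply/esym/Rintegral_itv_obnd_cbnd.
  by apply: integrableS (fi b c) => //; exact: subset_itv_oc_cc.
by rewrite -E; ring.
Qed.

Lemma sint_chasles f a b c : loc_int f -> sint a b f + sint b c f = sint a c f.
Proof.
move=> fi.
have H := fun a b c => @sint_chasles_le a b c f fi.
have [ab|/ltW ab] := leP a b; have [bc|/ltW bc] := leP b c; have [ac|/ltW ac] := leP a c.
- exact: H.
- have -> : a = b by apply/eqP; rewrite eq_le ab (le_trans bc ac).
  by rewrite sintxx add0r.
- by rewrite -(H a c b)// (sintC b c); ring.
- by rewrite (sintC c a) (sintC c b) -(H c a b)//; ring.
- by rewrite -(H b a c)// (sintC b a); ring.
- by rewrite (sintC c a) (sintC b a) -(H b c a)//; ring.
- have -> : b = c by apply/eqP; rewrite eq_le bc (le_trans ab ac).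
  by rewrite sintxx addr0.
- by rewrite (sintC c a) -(H c b a)// (sintC b a) (sintC c b); ring.
Qed.

Lemma sintD f g a b : loc_int f -> loc_int g ->
  sint a b (fun x => f x + g x) = sint a b f + sint a b g.
Proof. by move=> fi gi; rewrite /sint !RintegralD//; ring. Qed.

Lemma sintZ k f a b : loc_int f -> sint a b (fun x => k * f x) = k * sint a b f.
Proof. by move=> fi; rewrite /sint !RintegralZl//; ring. Qed.

Lemma sintN f a b : loc_int f -> sint a b (fun x => - f x) = - sint a b f.
Proof.
move=> fi; rewrite -mulN1r -sintZ//; congr (sint a b _).
by apply/funext => x; rewrite mulN1r.
Qed.

Lemma sintB f g a b : loc_int f -> loc_int g ->
  sint a b (fun x => f x - g x) = sint a b f - sint a b g.
Proof. by move=> fi gi; rewrite sintD ?sintN//; exact: loc_intN. Qed.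

Lemma sint_cst k a b : sint a b (fun=> k) = k * (b - a).
Proof.
wlog ab : a b / a <= b.
  move=> H; have [ab|/ltW ba] := leP a b; first exact: H.
  by rewrite sintC H//; ring.
rewrite sint_le// Rintegral_cst//= lebesgue_measure_itv/= lte_fin.
by case: ltP => //= ba; congr (_ * _); apply/eqP; rewrite eq_sym subr_eq0 eq_le ba ab.
Qed.

Lemma le_sint f g a b : a <= b -> loc_int f -> loc_int g ->
  (forall x, a <= x <= b -> f x <= g x) -> sint a b f <= sint a b g.
Proof.
move=> ab fi gi fg; rewrite !sint_le//; by apply: le_Rintegral => //= x; rewrite in_itv/=;
  exact: fg.
Qed.

Lemma sint_ge0 f a b : a <= b -> (forall x, a <= x <= b -> 0 <= f x) -> 0 <= sint a b f.
Proof.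
move=> ab f0; rewrite sint_le//; apply: Rintegral_ge0 => x /=.
by rewrite in_itv/=; exact: f0.
Qed.

Lemma norm_sint_le f a b : a <= b -> loc_int f -> `|sint a b f| <= sint a b (fun x => `|f x|).
Proof. by move=> ab fi; rewrite !sint_le//; apply: le_normr_Rintegral. Qed.

(** The base point is moved to [x - 1], so that near [x] the signed integral is, up to a constant,
    an ordinary integral over an interval. *)
Lemma sint_is_derive f c x : loc_int f -> {for x, continuous f} ->
  is_derive x 1 (fun y => sint c y f) (f x).
Proof.
move=> fi cf; pose a := x - 1.
have ax : a < x by rewrite /a; lra.
have [] := @continuous_FTC1_closed R f a x (x + 1) _ (fi _ _) ax cf; first lra.
set F := (fun y => _) => dF F'.
have DF : is_derive x 1 F (f x) by apply: DeriveDef => //; rewrite -derive1E.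
have DG : is_derive x 1 (fun y => sint c a f + F y) (f x).
  by rewrite -[f x]add0r; apply: is_deriveD.
apply: near_eq_is_derive DG; rewrite ?oner_eq0//.
near=> y; rewrite -(@sint_chasles f c a y)//; congr (_ + _); rewrite sint_le//.
by near: y; apply: filterS (lt_nbhsr ax) => t /ltW.
Unshelve. all: by end_near. Qed.

Lemma sint_continuous f c : loc_int f -> continuous (fun y => sint c y f).
Proof.
move=> fi x; pose a := x - 1; pose b := x + 1.
have ax : a < x by rewrite /a; lra.
have ab : x - 1 < x + 1 by lra.
have := @parameterized_integral_continuous R a b f.
rewrite /a /b => /(_ _ (fi _ _)) => H.
have {}H := H ltac:(lra).
have : {for x, continuous (fun y => sint c a f + parameterized_integral mu a y f)}.
  apply: (@continuousD _ R^o); first exact: cst_continuous.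
  have [+ _ _] := (continuous_within_itvP _ ab).1 H.
  by apply; rewrite in_itv/=; apply/andP; split; lra.
have E y : a <= y -> sint c a f + parameterized_integral mu a y f = sint c y f.
  by move=> ay; rewrite -(@sint_chasles f c a y)// (sint_le _ ay).
rewrite /prop_for /continuous_at /= E; last exact: ltW.
apply: cvg_trans; apply: near_eq_cvg; near=> y; rewrite E//.
by near: y; apply: filterS (lt_nbhsr ax) => t /ltW.
Unshelve. all: by end_near. Qed.


Let shiftr k : measurableTypeR R -> measurableTypeR R := fun x : R => (x + k)%R.

Let shiftr_measurable k : measurable_fun setT (shiftr k).
Proof. by apply: measurable_funD => //; exact: measurable_cst. Qed.

HB.instance Definition _ k := isMeasurableFun.Build _ _ _ _ (shiftr k) (shiftr_measurable k).

(** Lebesgue measure is determined by its values on half-open intervals, whose lengths a translation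
    preserves. *)
Lemma lebesgue_measure_shift (k : R) (A : set R) : measurable A ->
  pushforward mu (shiftr k) A = mu A.
Proof.
move=> mA; apply/esym/lebesgue_measure_unique => //= _ [[a b]] _ <-.
rewrite /pushforward.
have -> : shiftr k @^-1` `]a, b] = `]a - k, b - k]%classic.
  by apply/seteqP; split=> x /=; rewrite /shiftr !in_itv/= ltrBlDr lerBrDr.
rewrite /= !lebesgue_measure_itv/= !lte_fin ltrD2r; case: ifP => // _.
by rewrite -!EFinB; congr EFin; ring.
Qed.

Let preimage_shiftr k a b : shiftr k @^-1` `[a, b] = `[a - k, b - k]%classic.
Proof. by apply/seteqP; split=> x /=; rewrite /shiftr !in_itv/= lerBlDr lerBrDr. Qed.

Lemma integrable_shift k f a b : measurable_fun setT f ->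
  mu.-integrable `[a, b] (EFin \o f) ->
  mu.-integrable `[a - k, b - k] (EFin \o (fun x => f (x + k))).
Proof.
move=> mf /integrableP[_ fi]; apply/integrableP; split.
  apply/measurable_EFinP.
  exact: measurable_funS (measurableT_comp mf (shiftr_measurable k)).
rewrite -preimage_shiftr.
rewrite -(@ge0_integral_pushforward _ _ _ _ _ (shiftr k) (shiftr_measurable k) mu _ (fun x =>
  `|(f x)%:E|%E))//.
- by rewrite (eq_measure_integral mu)// => A mA _; exact: lebesgue_measure_shift.
- by apply: measurable_funTS; apply: measurableT_comp => //; exact/measurable_EFinP.
Qed.

Lemma Rintegral_shift k f a b : measurable_fun setT f ->
  mu.-integrable `[a, b] (EFin \o f) ->
  \int[mu]_(x in `[a - k, b - k]) f (x + k) = \int[mu]_(x in `[a, b]) f x.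
Proof.
move=> mf fi; rewrite /Rintegral; congr fine.
have fk := integrable_shift k mf fi.
rewrite -preimage_shiftr in fk *.
rewrite -(@integral_pushforward _ _ _ _ _ (shiftr k) (shiftr_measurable k) mu _ (fun x => (f
  x)%:E))//.
- by apply: eq_measure_integral => A mA _; exact: lebesgue_measure_shift.
- exact/measurable_EFinP.
Qed.

Lemma periodic_int f (k : int) : periodic f 1 -> forall x, f (x + k%:~R) = f x.
Proof.
move=> pf x; case: k => n; first by rewrite -pmulrn; exact: periodicn.
by rewrite NegzE mulrNz -pmulrn -[LHS](periodicn pf n.+1) subrK.
Qed.

Lemma integrable_setU f (A B : set R) : measurable_fun setT f ->
  measurable A -> measurable B -> mu.-integrable A (EFin \o f) ->
  mu.-integrable B (EFin \o f) -> mu.-integrable (A `|` B) (EFin \o f).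
Proof.
move=> mf mA mB /integrableP[_ fA] /integrableP[_ fB].
have mfE D : measurable_fun D (EFin \o f) by apply/measurable_EFinP/measurable_funTS.
apply/integrableP; split; first exact: mfE.
have mnE D : measurable_fun D (fun x => `|f x|%:E).
  by apply/measurable_EFinP; apply: measurableT_comp => //; exact: measurable_funTS.
rewrite -(setDUK (@subsetUl _ A B)) ge0_integral_setU//=.
- apply: lte_add_pinfty => //; apply: le_lt_trans fB; apply: ge0_subset_integral => //.
  + by apply: measurableD => //; exact: measurableU.
  + exact: mnE.
  + by move=> x [[]].
- by apply: measurableD => //; exact: measurableU.
- exact: mnE.
- by apply/disj_setPS => x [? []].
Qed.

(** The intervals [[-n, n]] are treated by induction: each step adds a translate of the unit
    interval at either end. *)
Lemma periodic_loc_int f : periodic f 1 -> measurable_fun setT f ->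
  mu.-integrable `[0, 1] (EFin \o f) -> loc_int f.
Proof.
move=> pf mf fi.
have H (n : nat) : mu.-integrable `[- n%:R, n%:R] (EFin \o f).
  elim: n => [|n IH]; first by apply: integrableS fi => //; apply: subset_itv;
    rewrite bnd_simp ?oppr0.
  have fk (k : int) : mu.-integrable `[- k%:~R, 1 - k%:~R] (EFin \o f).
    have := integrable_shift k%:~R mf fi; rewrite sub0r.
    by congr (_.-integrable _ (_ \o _)); apply/funext => x; rewrite periodic_int.
  have -> : `[- n.+1%:R, n.+1%:R]%classic =
      `[- n.+1%:R, - n%:R] `|` `[- n%:R, n%:R] `|` `[n%:R, n.+1%:R] :> set R.
    have n0 : 0 <= n%:R :> R by [].
    apply/seteqP; split => x /=; rewrite !in_itv/= -natr1.
      move=> /andP[x1 x2].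
      have [xn|xn] := leP x (- n%:R); first by left; left; rewrite x1.
      have [xn'|xn'] := leP x n%:R; first by left; right; rewrite (ltW xn).
      by right; rewrite (ltW xn').
    by case=> [[|]|] /andP[x1 x2]; apply/andP; split; lra.
  have i1 : mu.-integrable `[- n.+1%:R, - n%:R] (EFin \o f).
    have E : 1 - n.+1%:R = - n%:R :> R by rewrite -natr1; ring.
    by have := fk n.+1; rewrite -pmulrn E.
  have i2 : mu.-integrable `[n%:R, n.+1%:R] (EFin \o f).
    by have := fk (- n%:Z); rewrite mulrNz opprK -natr1 addrC; exact.
  have i3 := integrable_setU mf (measurable_itv _) (measurable_itv _) i1 IH.
  by apply: (integrable_setU mf _ (measurable_itv _) i3 i2); exact: measurableU.
move=> a b; have [n nP] : exists n : nat, `|a| + `|b| <= n%:R.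
  by exists (Num.trunc (`|a| + `|b|)).+1; apply/ltW/truncnS_gt.
apply: integrableS (H n) => // x /=; rewrite !in_itv/= => /andP[ax xb].
by apply/andP; split; have := normr_ge0 a; have := normr_ge0 b;
  have := ler_norm b; have := ler_norm (- a); rewrite normrN; lra.
Qed.

Lemma sint_shift k f a b : measurable_fun setT f -> loc_int f ->
  sint a b (fun x => f (x + k)) = sint (a + k) (b + k) f.
Proof.
move=> mf fi; rewrite /sint.
have E c d : \int[mu]_(x in `[c, d]) f (x + k) = \int[mu]_(x in `[c + k, d + k]) f x.
  by rewrite -(@Rintegral_shift k f (c + k) (d + k))// !addrK.
by rewrite !E.
Qed.

Lemma sint_periodic f a b : periodic f 1 -> measurable_fun setT f -> loc_int f ->
  sint (a + 1) (b + 1) f = sint a b f.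
Proof.
move=> pf mf fi; rewrite -sint_shift//; congr sint.
by apply/funext => x; exact: pf.
Qed.

Lemma sint_period f a : periodic f 1 -> measurable_fun setT f -> loc_int f ->
  sint a (a + 1) f = mean f.
Proof.
move=> pf mf fi; rewrite mean_sint -(@sint_chasles f a 0)// -(@sint_chasles f 0 1)//.
have := sint_periodic a 0 pf mf fi; rewrite add0r => E.
by rewrite (sintC (a + 1) 1) E; ring.
Qed.

End SignedIntegral.

(** * Primitives off a discrete set *)

Section PuncturedPrimitive.
Context {R : realType}.
Implicit Types (f g F G : R -> R) (a b c x y : R).
Local Notation mu := (@lebesgue_measure R).

Lemma punctured_ball (P : set R) x : (\forall y \near x^', P y) ->
  exists2 d : R, 0 < d & forall y, y != x -> `|y - x| < d -> P y.
Proof.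
move=> [d /= d0 H]; exists d => // y yx yd; apply: H => //=.
by rewrite distrC.
Qed.

(** A supremum argument: if the largest [s] up to which [G] stays above [G a] were smaller than [b],
    the hypothesis at [s] would carry it further. Only the right side of each point is inspected, so
    an isolated exceptional point does no harm. *)
Lemma right_nondecreasing G : continuous G ->
  (forall x, exists2 d, 0 < d & forall y, x < y < x + d -> G x <= G y) ->
  forall a b, a <= b -> G a <= G b.
Proof.
move=> cG dG a b ab.
pose A := [set x | a <= x <= b /\ forall y, a <= y <= x -> G a <= G y].
have Aa : A a by split=> [|y /andP[ay ya]]; rewrite ?lexx //; have -> : y = a by lra.
have supA : has_sup A by split; [exists a | exists b => x [/andP[]]].
pose s := sup A.
have as_ : a <= s by apply: ub_le_sup => //; exact: supA.2.
have sb : s <= b by apply: ge_sup => //; [exists a | move=> x [/andP[]]].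
have Gs y : a <= y < s -> G a <= G y.
  move=> /andP[ay ys].
  have [x [_ xH] yx] := sup_gt (ex_intro _ a Aa) ys.
  by apply: xH; rewrite ay (ltW yx).
have Gs' : G a <= G s.
  rewrite leNgt; apply/negP => H.
  have sa : a < s by rewrite lt_neqAle as_ andbT; apply/eqP => E; move: H; rewrite E ltxx.
  have [d /= d0 /= Hd] : \forall y \near s, G y < G a by exact: (cvgr_lt _ (cG s) _ H).
  pose y := Num.max a (s - d / 2).
  have : G y < G a.
    apply: Hd; rewrite /= /y ger0_norm; last by rewrite subr_ge0 ge_max as_/=; lra.
    by rewrite ltrBlDr -ltrBlDl lt_max; apply/orP; right; lra.
  by apply/negP; rewrite -leNgt Gs// /y le_max lexx/= gt_max sa/=; lra.
have As : A s.
  split; first by rewrite as_.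
  move=> y /andP[ay]; rewrite le_eqVlt => /predU1P[->//|ys].
  by apply: Gs; rewrite ay.
have [->//|sb'] := eqVneq b s.
have {sb'}sb1 : s < b by rewrite lt_neqAle eq_sym sb' sb.
have [d d0 Hd] := dG s.
pose y := Num.min b (s + d / 2).
have sy : s < y by rewrite lt_min sb1/=; lra.
have yb : y <= b by rewrite ge_min lexx.
have yd : y <= s + d / 2 by rewrite ge_min lexx orbT.
have Ay : A y.
  split; first by rewrite yb (le_trans as_ (ltW sy)).
  move=> u /andP[au uy]; have [us|su] := leP u s; first by apply: As.2; rewrite au.
  by apply: (le_trans Gs'); apply: Hd; lra.
by have := ub_le_sup supA.2 Ay; rewrite -/s leNgt sy.
Qed.

(** To the right of any point there is an interval free of exceptional points, where the mean value
    theorem applies. Asking for a punctured neighbourhood of every [x] is how a closed discrete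
    exceptional set is encoded, here and below. *)
Lemma punctured_nondecreasing G g : continuous G ->
  (forall x, \forall y \near x^', is_derive y (1 : R) G (g y) /\ 0 <= g y) ->
  forall a b, a <= b -> G a <= G b.
Proof.
move=> cG dG; apply: right_nondecreasing => // x.
have [d d0 Hd] := punctured_ball (dG x); exists d => // y xy.
have D v : v \in `]x, y[ -> is_derive v (1 : R) G (g v) /\ 0 <= g v.
  rewrite in_itv/= => /andP[sv vy]; apply: Hd; first by rewrite gt_eqF.
  by rewrite ger0_norm; lra.
apply: (@ger0_derive1_ndecr _ G x y) => //.
- by move=> v /D[[]].
- by move=> v /D[[dv ev] g0]; rewrite derive1E ev.
- exact: continuous_subspaceT.
- by apply: ltW; lra.
Qed.

Lemma punctured_constant G : continuous G ->
  (forall x, \forall y \near x^', is_derive y (1 : R) G 0) -> forall a b, G a = G b.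
Proof.
move=> cG dG.
have H a b : a <= b -> G a = G b.
  move=> ab; apply/eqP; rewrite eq_le; apply/andP; split.
    apply: (@punctured_nondecreasing G (fun=> 0)) => // x.
    by apply: filterS (dG x) => y.
  rewrite -lerN2; apply: (@punctured_nondecreasing (\- G) (fun=> 0)) => // x.
    by apply: cvgN; exact: cG.
  apply: filterS (dG x) => y dy; split=> //.
  by rewrite -oppr0; exact: is_deriveN.
by move=> a b; have [/H//|/ltW/H->] := leP a b.
Qed.

(** The difference of [F] and the primitive of [f] is continuous with zero derivative off the
    exceptional points. At these points [f] may be unbounded, as [1 / q] is at a collision; hence
    the hypothesis of integrability. *)
Lemma punctured_FTC F f : continuous F -> loc_int f ->
  (forall x, \forall y \near x^', {for y, continuous f} /\ is_derive y (1 : R) F (f y)) ->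
  forall a b, F b - F a = sint a b f.
Proof.
move=> cF fi dF a b.
have := @punctured_constant (fun x => F x - sint a x f) _ _ a b.
rewrite sintxx subr0 => -> //; first by ring.
- move=> x; apply: cvgB; [exact: cF|exact: sint_continuous].
- move=> x; apply: filterS (dF x) => y [cf dy].
  rewrite -(subrr (f y)); apply: is_deriveB => //.
  exact: sint_is_derive.
Qed.

(* Monotone convergence for the truncations [min(f, n)], whose integrals are
   bounded by the increments of [F]. *)
Lemma punctured_loc_int F f : continuous F -> measurable_fun setT f -> (forall x, 0 <= f x) ->
  (forall x, \forall y \near x^', {for y, continuous f} /\ is_derive y (1 : R) F (f y)) ->
  loc_int f.
Proof.
move=> cF mf f0 dF a b.
have [ab|ba] := leP a b; last by rewrite set_itv_ge ?bnd_simp -?ltNge//; exact: integrable_set0.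
pose fn (n : nat) x := Num.min (f x) n%:R.
have mfn n : measurable_fun setT (fn n).
  by apply: measurable_minr => //; exact: measurable_cst.
have fn_le n x : 0 <= fn n x <= n%:R.
  by rewrite /fn le_min f0 ler0n/= ge_min lexx orbT.
have fni n : loc_int (fn n).
  move=> c d; apply: measurable_bounded_integrable => //.
  - by rewrite /= lebesgue_measure_itv/=; case: ifP => // _; rewrite -EFinB ltry.
  - exact: measurable_funS (mfn n).
  - exists n%:R; split; first exact: num_real.
    move=> M nM x _ /=; have /andP[x0 xn] := fn_le n x.
    by rewrite ger0_norm// (le_trans xn)// ltW.
have bound n : sint a b (fn n) <= F b - F a.
  rewrite -subr_ge0.
  have := @punctured_nondecreasing (fun x => F x - sint a x (fn n)) (fun x => f x - fn n x) _
    _ a b ab.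
  rewrite sintxx subr0 => H; suff : F a <= F b - sint a b (fn n) by lra.
  apply: H.
  - by move=> x; apply: cvgB; [exact: cF|exact: sint_continuous].
  - move=> x; apply: filterS (dF x) => y [cf dy]; split.
      apply: is_deriveB => //; apply: sint_is_derive => //.
      by apply: (@continuous_min _ _ f (fun=> n%:R)) => //; exact: cst_continuous.
    by rewrite subr_ge0 ge_min lexx.
apply/integrableP; split; first exact/measurable_EFinP/measurable_funTS.
apply: (@le_lt_trans _ _ (F b - F a)%:E); last exact: ltry.
pose g n x := (fn n x)%:E.
have mgn n : measurable_fun `[a, b] (g n).
  by apply/measurable_EFinP; exact: measurable_funS (mfn n).
have -> : (\int[mu]_(x in `[a, b]) `|(EFin \o f) x|)%E = limn (fun n => \int[mu]_(x in `[a,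
  b]) g n x)%E.
  rewrite -monotone_convergence//.
  - apply: eq_integral => x _ /=; rewrite ger0_norm//.
    apply/esym/cvg_lim => //; apply: cvg_near_cst.
    near=> n; rewrite /g /fn min_l//.
    near: n; exact: nbhs_infty_ger.
  - by move=> n x _; rewrite /g lee_fin; have /andP[] := fn_le n x.
  - move=> x _ n m nm; rewrite /g lee_fin /fn le_min ge_min lexx/= ge_min ler_nat nm orbT.
    by [].
apply: lime_le.
- apply: ereal_nondecreasing_is_cvgn => n m nm; apply: ge0_le_integral => //.
  + by move=> x _; rewrite /g lee_fin; have /andP[] := fn_le n x.
  + exact: mgn.
  + exact: mgn.
  + by move=> x _; rewrite /g lee_fin /fn le_min ge_min lexx/= ge_min ler_nat nm orbT.
- apply: nearW => n; have := bound n; rewrite sint_le// -lee_fin.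
  rewrite /Rintegral fineK//; exact: (integrable_fin_num _ (fni n a b)).
Unshelve. all: by end_near. Qed.

End PuncturedPrimitive.

(** * The Sobolev space of the circle *)

Section ContinuousArith.
Context {R : realType}.
Implicit Types f g : R -> R.

Lemma continuous_add f g : continuous f -> continuous g -> continuous (fun x => f x + g x).
Proof. by move=> cf cg x; apply: cvgD; [exact: cf|exact: cg]. Qed.

Lemma continuous_sub f g : continuous f -> continuous g -> continuous (fun x => f x - g x).
Proof. by move=> cf cg x; apply: cvgB; [exact: cf|exact: cg]. Qed.

Lemma continuous_mul f g : continuous f -> continuous g -> continuous (fun x => f x * g x).
Proof. by move=> cf cg x; apply: cvgM; [exact: cf|exact: cg]. Qed.

Lemma continuous_scale k f : continuous f -> continuous (fun x => k * f x).
Proof. by move=> cf x; apply: cvgMr; exact: cf. Qed.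

Lemma continuous_cst (k : R) : continuous (fun _ : R => k : R).
Proof. by move=> x; exact: cvg_cst. Qed.

Lemma derive_continuous f (df : R -> R) :
  (forall x : R, is_derive x (1 : R) f (df x)) -> continuous f.
Proof.
by move=> H x; apply/differentiable_continuous/derivable1_diffP; case: (H x).
Qed.

End ContinuousArith.

(** * Square integrable functions on the circle and the Cauchy-Schwarz inequality *)

Section L2.
Context {R : realType}.
Implicit Types (f g h u v w z F G D M : R -> R) (a b c x y : R).

Lemma loc_int_le f g : measurable_fun setT f -> loc_int g ->
  (forall x, `|f x| <= g x) -> loc_int f.
Proof.
move=> mf gi fg a b; apply: le_integrable (gi a b) => //.
  by apply/measurable_EFinP; exact: measurable_funS mf.
move=> x _; rewrite /= lee_fin; apply: le_trans (fg x) _.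
exact: ler_norm.
Qed.

Lemma measurable_sqr f : measurable_fun setT f -> measurable_fun setT (fun x => f x ^+ 2).
Proof. by move=> mf; exact: measurable_funX. Qed.

Lemma L2_sqr_loc_int u : L2_circle u -> loc_int (fun x => u x ^+ 2).
Proof.
case=> pu mu_ iu; apply: periodic_loc_int => //; last exact: measurable_sqr.
by move=> x /=; rewrite pu.
Qed.

Lemma L2_mul_loc_int u v : L2_circle u -> L2_circle v -> loc_int (fun x => u x * v x).
Proof.
move=> Lu Lv.
apply: (@loc_int_le _ (fun x => u x ^+ 2 + v x ^+ 2)).
- by case: Lu => _ mu_ _; case: Lv => _ mv _; exact: measurable_funM.
- by apply: loc_intD; exact: L2_sqr_loc_int.
- move=> x; rewrite normrM -(real_normK (num_real (u x))) -(real_normK (num_real (v x))).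
  by have := sqr_ge0 (`|u x| - `|v x|); have := sqr_ge0 (`|u x| + `|v x|); nra.
Qed.

Lemma L2_continuous u : periodic u 1 -> continuous u -> L2_circle u.
Proof.
move=> pu cu; split => //; first exact: continuous_measurable_fun.
have : continuous (fun x => u x ^+ 2).
  by move=> x; apply: cvgM; exact: cu.
by move=> /loc_int_continuous; exact.
Qed.

Lemma L2_cst k : L2_circle (fun=> k : R).
Proof. by apply: L2_continuous => // x; exact: cvg_cst. Qed.

Lemma L2_loc_int u : L2_circle u -> loc_int u.
Proof.
move=> Lu; have := L2_mul_loc_int Lu (L2_cst 1).
by under eq_fun do rewrite mulr1.
Qed.

Lemma L2Z k u : L2_circle u -> L2_circle (fun x => k * u x).
Proof.
move=> Lu; have [pu mu_ iu] := Lu; split.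
- by move=> x; rewrite pu.
- by apply: measurable_funM => //; exact: measurable_cst.
- have := loc_intZ (k ^+ 2) (L2_sqr_loc_int Lu).
  move=> /(_ 0 1); congr (_.-integrable _ _); apply/funext => x /=.
  by rewrite exprMn.
Qed.

Lemma L2D u v : L2_circle u -> L2_circle v -> L2_circle (fun x => u x + v x).
Proof.
move=> Lu Lv; have [pu mu_ iu] := Lu; have [pv mv iv] := Lv; split.
- by move=> x; rewrite pu pv.
- exact: measurable_funD.
- have := loc_intD (loc_intD (L2_sqr_loc_int Lu) (L2_sqr_loc_int Lv)) (loc_intZ 2
  (L2_mul_loc_int Lu Lv)).
  move=> /(_ 0 1); congr (_.-integrable _ _); apply/funext => x /=.
  by congr EFin; ring.
Qed.

Lemma L2B u v : L2_circle u -> L2_circle v -> L2_circle (fun x => u x - v x).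
Proof.
move=> Lu Lv; under eq_fun do rewrite -mulN1r.
exact: L2D (L2Z _ Lv).
Qed.

Lemma dotC u v : dot u v = dot v u.
Proof. by congr mean; apply/funext => x; rewrite mulrC. Qed.

Lemma dotE u v : dot u v = sint 0 1 (fun x => u x * v x).
Proof. by rewrite -mean_sint. Qed.

Lemma dotDl u v w : L2_circle u -> L2_circle v -> L2_circle w ->
  dot (fun x => u x + v x) w = dot u w + dot v w.
Proof.
move=> Lu Lv Lw; rewrite !dotE -sintD; try exact: L2_mul_loc_int.
by congr sint; apply/funext => x; ring.
Qed.

Lemma dotZl k u v : L2_circle u -> L2_circle v -> dot (fun x => k * u x) v = k * dot u v.
Proof.
move=> Lu Lv; rewrite !dotE -sintZ; last exact: L2_mul_loc_int.
by congr sint; apply/funext => x; ring.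
Qed.

Lemma dotBl u v w : L2_circle u -> L2_circle v -> L2_circle w ->
  dot (fun x => u x - v x) w = dot u w - dot v w.
Proof.
move=> Lu Lv Lw; rewrite !dotE -sintB; try exact: L2_mul_loc_int.
by congr sint; apply/funext => x; ring.
Qed.

Lemma dotDr u v w : L2_circle u -> L2_circle v -> L2_circle w ->
  dot w (fun x => u x + v x) = dot w u + dot w v.
Proof. by move=> *; rewrite dotC dotDl// !(dotC w). Qed.

Lemma dotZr k u v : L2_circle u -> L2_circle v -> dot v (fun x => k * u x) = k * dot v u.
Proof. by move=> *; rewrite dotC dotZl// (dotC v). Qed.

Lemma dot_ge0 u : 0 <= dot u u.
Proof. by rewrite dotE sint_ge0// => x _; rewrite -expr2 sqr_ge0. Qed.

Lemma norm2_ge0 u : 0 <= norm2 u.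
Proof. exact: sqrtr_ge0. Qed.

Lemma norm2_sqr u : norm2 u ^+ 2 = dot u u.
Proof. by rewrite sqr_sqrtr// dot_ge0. Qed.

Lemma cauchy_schwarz u v : L2_circle u -> L2_circle v ->
  `|dot u v| <= norm2 u * norm2 v.
Proof.
move=> Lu Lv.
have H s : 0 <= dot u u + 2 * s * dot u v + s ^+ 2 * dot v v.
  have := dot_ge0 (fun x => u x + s * v x).
  have Lsv := L2Z s Lv.
  rewrite dotDl ?dotDr ?dotZl ?dotZr//; try exact: L2D.
  rewrite (dotC v u) => /le_trans; apply; rewrite le_eqVlt; apply/orP; left; apply/eqP; ring.
rewrite -(ler_pXn2r (n := 2))// ?nnegrE ?mulr_ge0 ?norm2_ge0//.
rewrite exprMn !norm2_sqr real_normK ?num_real//.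
have [v0|v0] := eqVneq (dot v v) 0.
  have [->|uv0] := eqVneq (dot u v) 0; first by rewrite expr0n/= mulr_ge0 ?dot_ge0.
  (* Here the quadratic of [H] degenerates to an affine function of [s], and this [s] gives it the
     value -1. *)
  have := H (- (dot u u + 1) / (2 * dot u v)); rewrite v0 mulr0 addr0.
  have -> : 2 * (- (dot u u + 1) / (2 * dot u v)) * dot u v = - (dot u u + 1) by field.
  lra.
have vp : 0 < dot v v by rewrite lt_neqAle eq_sym v0 dot_ge0.
(* The minimizer of the quadratic. *)
have := H (- dot u v / dot v v).
have -> : dot u u + 2 * (- dot u v / dot v v) * dot u v + (- dot u v / dot v v) ^+ 2 * dot v v
  = (dot u u * dot v v - dot u v ^+ 2) / dot v v by field.
by rewrite pmulr_lge0 ?invr_gt0// subr_ge0.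
Qed.

Lemma norm2_cst1 : norm2 (fun=> 1 : R) = 1.
Proof. by rewrite /norm2 dotE mul1r sint_cst mul1r subr0 sqrtr1. Qed.

Lemma L2_norm u : L2_circle u -> L2_circle (fun x => `|u x|).
Proof.
case=> pu mu_ iu; split.
- by move=> x; rewrite pu.
- exact: measurableT_comp.
- move: iu; congr (_.-integrable _ _); apply/funext => x /=.
  by rewrite real_normK ?num_real.
Qed.

Lemma norm2_norm u : norm2 (fun x => `|u x|) = norm2 u.
Proof.
congr Num.sqrt; congr mean; apply/funext => x.
by rewrite -expr2 real_normK ?num_real// expr2.
Qed.

(** The integral of [|u|] over the subinterval is at most the one over the unit interval, which
    Cauchy-Schwarz against the constant 1 bounds. *)
Lemma sint_norm_le_norm2 u a b : L2_circle u -> 0 <= a -> a <= b -> b <= 1 ->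
  `|sint a b u| <= norm2 u.
Proof.
move=> Lu a0 ab b1; have iu := L2_loc_int Lu.
apply: le_trans (norm_sint_le ab iu) _.
have Lnu := L2_norm Lu; have inu := L2_loc_int Lnu.
have : sint 0 1 (fun x => `|u x|) <= norm2 u.
  have := cauchy_schwarz Lnu (L2_cst 1); rewrite norm2_cst1 mulr1 norm2_norm.
  rewrite dotE; under eq_fun do rewrite mulr1.
  by apply: le_trans; exact: ler_norm.
apply: le_trans.
rewrite -(@sint_chasles _ _ 0 a 1)// -(@sint_chasles _ _ a b 1)//.
have H0 : 0 <= sint 0 a (fun x => `|u x|) by apply: sint_ge0.
have H1 : 0 <= sint b 1 (fun x => `|u x|) by apply: sint_ge0.
by lra.
Qed.

Lemma dot_eq0_l u v : L2_circle u -> L2_circle v -> norm2 u = 0 -> dot u v = 0.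
Proof.
move=> Lu Lv u0; have := cauchy_schwarz Lu Lv.
by rewrite u0 mul0r normr_le0 => /eqP.
Qed.

End L2.

(** * Weak derivatives and integration by parts *)

Section H1.
Context {R : realType}.
Implicit Types (f g h u v w z F G D M : R -> R) (a b c x y : R).
Local Notation mu := (@lebesgue_measure R).

Lemma wderivP z : H1 z -> is_weak_derivative z (wderiv z).
Proof. by case=> _ [v vP]; rewrite /wderiv; apply: xgetPex; exists v. Qed.

Lemma wderiv_L2 z : H1 z -> L2_circle (wderiv z).
Proof. by move=> /wderivP[]. Qed.

Lemma H1_continuous z : H1 z -> continuous z.
Proof.
move=> Hz; have [Lv zv] := wderivP Hz.
have -> : z = fun x => z 0 + sint 0 x (wderiv z).
  by apply/funext => x; rewrite -zv addrC subrK.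
apply: continuous_add; first exact: continuous_cst.
exact: sint_continuous (L2_loc_int Lv).
Qed.

Lemma H1_L2 z : H1 z -> L2_circle z.
Proof. by move=> Hz; apply: L2_continuous; [case: Hz|exact: H1_continuous]. Qed.

Lemma weak_derivativeD z h v w : is_weak_derivative z v -> is_weak_derivative h w ->
  is_weak_derivative (z \+ h) (fun x => v x + w x).
Proof.
move=> [Lv zv] [Lw hw]; split; first exact: L2D.
by move=> a b; rewrite sintD -?zv -?hw /=; [ring|exact: L2_loc_int..].
Qed.

Lemma weak_derivativeZ k z v : is_weak_derivative z v ->
  is_weak_derivative (fun x => k * z x) (fun x => k * v x).
Proof.
move=> [Lv zv]; split; first exact: L2Z.
by move=> a b; rewrite sintZ -?zv -?mulrBr//; exact: L2_loc_int.
Qed.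

Lemma H1D z h : H1 z -> H1 h -> H1 (z \+ h).
Proof.
move=> Hz Hh; split; first by move=> x /=; rewrite (Hz.1 x) (Hh.1 x).
by eexists; exact: weak_derivativeD (wderivP Hz) (wderivP Hh).
Qed.

Lemma H1Z k z : H1 z -> H1 (fun x => k * z x).
Proof.
move=> Hz; split; first by move=> x /=; rewrite (Hz.1 x).
by eexists; exact: weak_derivativeZ (wderivP Hz).
Qed.

Lemma weak_derivative_cst k : is_weak_derivative (fun=> k : R) (fun=> 0).
Proof. by split; [exact: L2_cst|move=> a b; rewrite sint_cst mul0r subrr]. Qed.

Lemma H1_cst k : H1 (fun=> k : R).
Proof. by split=> //; eexists; exact: weak_derivative_cst. Qed.

Lemma C1_weak_derivative z w : periodic z 1 -> continuous w ->
  (forall x, is_derive x (1 : R) z (w x)) -> is_weak_derivative z w.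
Proof.
move=> pz cw dz.
have cz : continuous z.
  by move=> x; apply/differentiable_continuous/derivable1_diffP; case: (dz x).
split.
  apply: L2_continuous => // x.
  have D1 := dz x; have D2 := dz (x + 1).
  have [_ <-] : is_derive x (1 : R) (fun y => z (y + 1)) (w (x + 1)).
    have := is_derive1_comp (f := z) (g := fun y => y + 1) (x := x) (a := w (x + 1)) (b := 1).
    rewrite ?mulr1 ?mul1r; apply => //.
    by rewrite -[X in is_derive _ _ _ X]addr0; exact: is_deriveD.
  by case: D1 => _ <-; congr ('D_1 _ x); apply/funext => y; exact: pz.
move=> a b; apply: punctured_FTC => //; first exact: loc_int_continuous.
by move=> x; near=> y; split; [exact: cw|exact: dz].
Unshelve. all: by end_near. Qed.

(** By Lebesgue differentiation [w] is almost everywhere the derivative of its primitive, which is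
    zero. *)
Lemma sint_eq0_ae w : L2_circle w -> (forall a b, sint a b w = 0) -> norm2 w = 0.
Proof.
move=> Lw w0; have iw := L2_loc_int Lw.
have mw : measurable_fun setT w by case: Lw.
have lw : locally_integrable setT w.
  split => //; first exact: openT.
  move=> K _ cK.
  have [M [_ HM]] := compact_bounded cK.
  have KM : K `<=` `[- (M + 1), M + 1].
    move=> x Kx; have := HM (M + 1) _ x Kx.
    by rewrite ltrDl ltr01 => /(_ isT) /=; rewrite in_itv/= ler_norml.
  have /integrableP[_] := iw (- (M + 1)) (M + 1).
  apply: le_lt_trans; apply: ge0_subset_integral => //; first exact: compact_measurable.
  by apply/measurable_EFinP; apply: measurableT_comp => //; exact: measurable_funS mw.
have := @FTC1 R w (BLeft 0) (fun y => iw 0 y) lw.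
set G := (fun x => _) => aeG.
have G0 x : G x = 0.
  rewrite /G; have [x0|x0] := leP 0 x; first by rewrite -sint_le.
  by rewrite set_itv_ge ?bnd_simp -?ltNge// Rintegral_set0.
rewrite /norm2 /dot /mean /Rintegral.
suff -> : (\int[mu]_(x in `[0%R, 1%R]) (w x * w x)%:E = \int[mu]_(x in `[0%R, 1%R]) cst 0 x)%E.
  by rewrite integral_cst//= mul0e/= sqrtr0.
(* The almost everywhere statement concerns points to the right of 0, so the endpoint 0 is removed
   from the domain. *)
rewrite -[LHS]integral_itv_obnd_cbnd; last first.
  by apply/measurable_EFinP; apply: measurable_funM; exact: measurable_funS mw.
rewrite -[RHS]integral_itv_obnd_cbnd; last exact: measurable_cst.
apply: ae_eq_integral => //.
  apply/measurable_EFinP; apply: measurable_funM; exact: measurable_funS mw.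
move: aeG; apply: filterS; first exact: (ae_filter_ringOfSetsType mu).
move=> x H x01.
have [|_ ] := H _.
  by move: x01; rewrite /= in_itv/= lte_fin => /andP[].
have -> : G = cst 0 by apply/funext.
by rewrite derive1_cst => <-; rewrite mulr0.
Qed.

Lemma weak_derivative_unique z v w : is_weak_derivative z v -> is_weak_derivative z w ->
  norm2 (fun x => v x - w x) = 0.
Proof.
move=> [Lv zv] [Lw zw]; apply: sint_eq0_ae; first exact: L2B.
by move=> a b; rewrite sintB -?zv -?zw ?subrr//; exact: L2_loc_int.
Qed.

(** The choice made in [wderiv] is invisible to integrals: this is how it gets replaced by an
    explicit weak derivative. *)
Lemma dot_wderiv z v u : is_weak_derivative z v -> L2_circle u -> dot (wderiv z) u = dot v u.
Proof.
move=> zv Lu; have zw : is_weak_derivative z (wderiv z) by rewrite /wderiv; apply: xgetPex;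
  exists v.
apply/eqP; rewrite -subr_eq0 -dotBl; [|by case: zw|by case: zv|by []].
apply/eqP/dot_eq0_l => //; last exact: weak_derivative_unique zw zv.
by apply: L2B; [case: zw|case: zv].
Qed.

Lemma dot_wderiv2 z v : is_weak_derivative z v -> dot (wderiv z) (wderiv z) = dot v v.
Proof.
move=> zv; have zw : is_weak_derivative z (wderiv z) by rewrite /wderiv; apply: xgetPex;
  exists v.
by rewrite (dot_wderiv zv) ?(dotC v) ?(dot_wderiv zv)//; [case: zv|case: zw].
Qed.

(** [D] has zero derivative with respect to [M]. For each [e], both [e * M + D] and [e * M - D] are
    locally nondecreasing to the right of every point, hence nondecreasing; then [e] tends to 0. *)
Lemma eq_of_small_increments D M : continuous D -> continuous M ->
  (forall e : R, 0 < e -> forall x, exists2 d : R, 0 < d &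
     forall y, x < y < x + d -> `|D y - D x| <= e * (M y - M x)) ->
  forall a b, a <= b -> D b = D a.
Proof.
move=> cD cM H a b ab; apply/eqP; rewrite -subr_eq0 -normr_le0.
suff S (e : R) : 0 < e -> `|D b - D a| <= e * (M b - M a).
  apply/ler_addgt0Pl => e e0; rewrite addr0.
  have M0 : 0 <= M b - M a.
    by have := S 1 ltr01; rewrite mul1r; apply: le_trans.
  apply: le_trans (S (e / (M b - M a + 1)) _) _; first by rewrite divr_gt0//; lra.
  rewrite mulrAC ler_pdivrMr; last lra.
  by rewrite ler_pM2l//; lra.
move=> e0; rewrite ler_norml mulrBr; apply/andP; split.
  suff : e * M a + D a <= e * M b + D b by lra.
  apply: (@right_nondecreasing R (fun x => e * M x + D x)) => //.
    exact: (@continuous_add _ (fun x => e * M x) D (continuous_scale (k := e) cM) cD).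
  move=> x; have [d d0 Hd] := H e e0 x; exists d => // y /Hd.
  by rewrite ler_norml mulrBr => /andP[]; lra.
suff : e * M a - D a <= e * M b - D b by lra.
apply: (@right_nondecreasing R (fun x => e * M x - D x)) => //.
  exact: (@continuous_sub _ (fun x => e * M x) D (continuous_scale (k := e) cM) cD).
move=> x; have [d d0 Hd] := H e e0 x; exists d => // y /Hd.
by rewrite ler_norml mulrBr => /andP[]; lra.
Qed.

(* [F h - int (F w + f h)] has increments that are small with respect to those of
   [int (|w| + |f|)], hence is constant. *)
Lemma integration_by_parts_AC F f h w : measurable_fun setT w -> loc_int w ->
  (forall a b, h b - h a = sint a b w) ->
  (forall x, is_derive x (1 : R) F (f x)) -> continuous f ->
  forall a b, a <= b -> F b * h b - F a * h a = sint a b (fun x => F x * w x + f x * h x).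
Proof.
move=> mw iw hw dF cf a b ab.
have cF : continuous F.
  by move=> x; apply/differentiable_continuous/derivable1_diffP; case: (dF x).
have ch : continuous h.
  have -> : h = fun x => h 0 + sint 0 x w.
    by apply/funext => x; rewrite -hw addrC subrK.
  apply: continuous_add; first exact: continuous_cst.
  exact: sint_continuous.
have Fb x y : F y - F x = sint x y f.
  apply: punctured_FTC => //; first exact: loc_int_continuous.
  by move=> u; near=> v; split; [exact: cf|exact: dF].
have mF := continuous_measurable_fun cF.
have cfh : continuous (fun x => f x * h x) by exact: continuous_mul.
have iFw : loc_int (fun x => F x * w x).
  move=> c d; have [cd|dc] := leP c d; last by rewrite set_itv_ge ?bnd_simp -?ltNge//;
    exact: integrable_set0.
  have [C HC] : exists C, forall x, c <= x <= d -> `|F x| <= C.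
    have /compact_bounded[M [_ HM]] : compact (F @` `[c, d]).
      by apply: continuous_compact; [exact: continuous_subspaceT|exact: segment_compact].
    exists (M + 1) => x xcd; apply: (HM (M + 1)); first by rewrite ltrDl.
    by exists x; rewrite //= in_itv.
  apply: le_integrable (integrableZl _ C (integrable_norm (iw c d))) => //.
    by apply/measurable_EFinP; apply: measurable_funM;
      apply: (measurable_funS _ (@subsetT _ _)).
  move=> x /=; rewrite in_itv/= => /HC FC; rewrite lee_fin normrM.
  rewrite (ger0_norm (mulr_ge0 _ _))//; last exact: le_trans (FC).
  by rewrite ler_wpM2r.
have iG : loc_int (fun x => F x * w x + f x * h x).
  by apply: loc_intD => //; exact: loc_int_continuous.
have iM : loc_int (fun x => `|w x| + `|f x|).
  by apply: loc_intD; apply: loc_int_norm => //; exact: loc_int_continuous.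
pose D x := F x * h x - sint a x (fun x => F x * w x + f x * h x).
pose M x := sint a x (fun x => `|w x| + `|f x|).
suff : D b = D a by rewrite /D sintxx; lra.
apply: (@eq_of_small_increments D M) => //.
- by apply: continuous_sub; [exact: continuous_mul|exact: sint_continuous].
- exact: sint_continuous.
move=> e e0 x.
have : \forall y \near x, `|F x - F y| < e / 2 /\ `|h x - h y| < e / 2.
  near=> y; split; near: y.
    by move: (cF x) => /cvgrPdist_lt; apply; lra.
  by move: (ch x) => /cvgrPdist_lt; apply; lra.
move=> [d /= d0 Hd]; exists d => // y /andP[xy yd].
have xyle := ltW xy.
have near_xy t : x <= t <= y -> `|F x - F t| < e / 2 /\ `|h x - h t| < e / 2.
  by move=> xty; apply: Hd; rewrite /= ler0_norm; lra.
(* From [F y * h y - F x * h x = F x * (h y - h x) + h y * (F y - F x)]; the cofactors of [w] and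
   [f] become differences over a short interval. *)
have -> : D y - D x = sint x y (fun t => (F x - F t) * w t + f t * (h y - h t)).
  rewrite /D -(@sint_chasles _ _ a x y)//.
  have -> : (fun t => (F x - F t) * w t + f t * (h y - h t)) =
     (fun t => (F x * w t + h y * f t) - (F t * w t + f t * h t)).
    by apply/funext => t; ring.
  rewrite sintB//; last first.
    by apply: loc_intD; apply: loc_intZ => //; exact: loc_int_continuous.
  have cif : loc_int f by exact: loc_int_continuous.
  rewrite (@sintD _ (fun t => F x * w t) (fun t => h y * f t)) ?sintZ//; try exact: loc_intZ.
  by rewrite -hw -Fb; ring.
have -> : M y - M x = sint x y (fun t => `|w t| + `|f t|).
  by rewrite /M -(@sint_chasles _ _ a x y)//; ring.
have iD : loc_int (fun t => (F x - F t) * w t + f t * (h y - h t)).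
  have -> : (fun t => (F x - F t) * w t + f t * (h y - h t)) =
     (fun t => (F x * w t + h y * f t) - (F t * w t + f t * h t)).
    by apply/funext => t; ring.
  by apply: loc_intB => //; apply: loc_intD; apply: loc_intZ => //; exact: loc_int_continuous.
apply: le_trans (norm_sint_le xyle iD) _.
rewrite -sintZ//; apply: le_sint => //; [exact: loc_int_norm|exact: loc_intZ|].
move=> t xty; have [H1 H2] := near_xy t xty.
have [_ H3] : `|F x - F y| < e / 2 /\ `|h x - h y| < e / 2 by apply: near_xy; rewrite xyle lexx.
apply: le_trans (ler_normD _ _) _; rewrite !normrM mulrDr lerD//.
  by rewrite ler_wpM2r//; lra.
rewrite mulrC ler_wpM2r//.
have -> : h y - h t = - (h x - h y) + (h x - h t) by ring.
by apply: le_trans (ler_normD _ _) _; rewrite normrN; lra.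
Unshelve. all: by end_near. Qed.

End H1.

(** * The Euler-Lagrange equation *)

Section EulerLagrange.
Context {R : realType}.
Implicit Types (f g h u v w z F G : R -> R) (a b c x y : R).

Lemma periodic_reduce f : periodic f 1 -> forall x, exists2 y, 0 <= y < 1 & f x = f y.
Proof.
move=> pf x; exists (x - (Num.floor x)%:~R).
  by have := floor_itv x; rewrite intrD => /andP[? ?]; apply/andP; split; lra.
by rewrite -[RHS](periodic_int (Num.floor x) pf) subrK.
Qed.

(** The Sobolev embedding: [|h x|] exceeds any [|h y|] by at most [norm2 (wderiv h)], and the
    average of [|h y|] over a period is at most [norm2 h]. *)
Lemma H1_sup_le h : H1 h -> forall x, `|h x| <= norm2 h + norm2 (wderiv h).
Proof.
move=> Hh x; have [x' /andP[x'0 x'1] ->] := periodic_reduce Hh.1 x.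
have [Lw hw] := wderivP Hh; have Lh := H1_L2 Hh; have iw := L2_loc_int Lw.
have H y : 0 <= y <= 1 -> `|h x'| <= `|h y| + norm2 (wderiv h).
  move=> /andP[y0 y1]; have -> : h x' = h y + (h x' - h y) by ring.
  apply: le_trans (ler_normD _ _) _; rewrite lerD2l hw.
  have [yx|/ltW xy] := leP y x'; first by apply: sint_norm_le_norm2 => //; exact: ltW.
  by rewrite sintC normrN; apply: sint_norm_le_norm2.
have Ln := L2_norm Lh.
have iC k : loc_int (fun=> k : R) by exact: L2_loc_int (L2_cst k).
have : sint 0 1 (fun=> `|h x'|) <= sint 0 1 (fun y => `|h y| + norm2 (wderiv h)).
  by apply: le_sint => //; apply: loc_intD => //; exact: L2_loc_int.
rewrite sint_cst subr0 mulr1 sintD ?sint_cst ?subr0 ?mulr1//; last exact: L2_loc_int.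
move=> /le_trans; apply; rewrite lerD2r.
have := cauchy_schwarz Ln (L2_cst 1); rewrite norm2_cst1 mulr1 norm2_norm.
rewrite dotE; under eq_fun do rewrite mulr1.
by apply: le_trans; exact: ler_norm.
Qed.

Lemma sint_primitive f : continuous f -> forall x, is_derive x (1 : R) (fun y => sint 0 y f)
  (f x).
Proof. by move=> cf x; apply: sint_is_derive; [exact: loc_int_continuous|exact: cf]. Qed.

Lemma primitive_periodic f : periodic f 1 -> continuous f -> mean f = 0 ->
  periodic (fun y => sint 0 y f) 1.
Proof.
move=> pf cf f0 x; have fi := loc_int_continuous cf.
rewrite -(@sint_chasles _ _ 0 x (x + 1))// sint_period ?f0 ?addr0//.
exact: continuous_measurable_fun.
Qed.

Lemma weak_parts z w f h : periodic z 1 -> (forall x, is_derive x (1 : R) z (w x)) ->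
  (forall x, is_derive x (1 : R) w (f x)) -> continuous f -> H1 h ->
  dot (wderiv z) (wderiv h) + dot f h = 0.
Proof.
move=> pz dz dw cf Hh; have cw := derive_continuous dw.
have zw := C1_weak_derivative pz cw dz; have [Lw' hw'] := wderivP Hh.
have [pw mw _] := Lw'.
rewrite (dot_wderiv zw)// !dotE -sintD.
- rewrite -(@integration_by_parts_AC _ w f h (wderiv h))//; last exact: L2_loc_int.
  have [[pww _ _] _] := zw.
  have := pww 0; have := Hh.1 0; rewrite add0r => -> ->; rewrite subrr; done.
- by apply: L2_mul_loc_int => //; case: zw.
- apply: loc_int_continuous; apply: continuous_mul => //; exact: H1_continuous.
Qed.

(** Testing with the constant 1 gives [mean f = 0], so [f] has a periodic primitive; [w] is the one
    of mean zero, and it has a periodic primitive [P] in turn. The test function [h = z - P] has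
    weak derivative [r = v - w]. The hypothesis for [h], integration by parts for [F] and [h], and
    the periodicity of [h] give [dot r r = 0], so [z - P] is constant. *)
Lemma du_bois_reymond z f : H1 z -> periodic f 1 -> continuous f ->
  (forall h, H1 h -> dot (wderiv z) (wderiv h) + dot f h = 0) ->
  exists2 w, (forall x, is_derive x (1 : R) z (w x)) & (forall x, is_derive x (1 : R) w (f x)).
Proof.
move=> Hz pf cf H; have [Lv zv] := wderivP Hz; set v := wderiv z in H Lv zv *.
have Lf := L2_continuous pf cf.
have f0 : mean f = 0.
  have := H _ (H1_cst 1); rewrite dotC (dot_wderiv (weak_derivative_cst 1))//.
  rewrite !dotE; under eq_fun do rewrite mul0r.
  rewrite sint_cst mul0r add0r => E; rewrite mean_sint -[RHS]E; congr sint.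
  by apply/funext => x; rewrite mulr1.
pose F x := sint 0 x f.
have dF := sint_primitive cf; have pF := primitive_periodic pf cf f0.
have cF : continuous F := derive_continuous dF.
have LF := L2_continuous pF cF.
pose m := - mean F; pose w x := F x + m.
have pw : periodic w 1 by move=> x; rewrite /w; congr (_ + _); exact: pF.
have cw : continuous w by apply: continuous_add => //; exact: continuous_cst.
have Lw := L2_continuous pw cw.
have w0 : mean w = 0.
  rewrite mean_sint /w sintD ?sint_cst -?mean_sint; last 2 first.
  - exact: L2_loc_int.
  - exact: L2_loc_int (L2_cst m).
  by rewrite /m; ring.
pose P x := sint 0 x w.
have dP := sint_primitive cw; have pP := primitive_periodic pw cw w0.
have Pw := C1_weak_derivative pP cw dP.
have HP : H1 P by split=> //; exists w.
pose h := z \+ (fun x => (- 1) * P x).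
have Hh : H1 h by apply: H1D => //; exact: H1Z.
have hvw : is_weak_derivative h (fun x => v x + (- 1) * w x).
  by apply: weak_derivativeD; [split|exact: weak_derivativeZ].
set r := fun x => _ in hvw; have [Lr hr] := hvw.
have ir := L2_loc_int Lr.
have h01 : h 1 = h 0 by have := Hh.1 0; rewrite add0r.
have E1 : dot v r + dot f h = 0.
  by have := H _ Hh; rewrite dotC (dot_wderiv hvw)// (dotC r).
have E2 : dot F r + dot f h = 0.
  rewrite !dotE -sintD.
  - rewrite -(@integration_by_parts_AC _ F f h r)//; last by case: Lr.
    have F10 : F 1 = F 0 by rewrite -[1]add0r; exact: pF.
    by rewrite F10 h01 subrr.
  - exact: L2_mul_loc_int.
  - by apply: L2_mul_loc_int => //; exact: H1_L2.
have E3 : dot (fun=> m) r = 0.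
  rewrite dotE sintZ//; rewrite -hr h01 subrr mulr0; done.
have r0 : norm2 r = 0.
  rewrite /norm2; suff -> : dot r r = 0 by rewrite sqrtr0.
  have -> : dot r r = dot v r - dot F r - dot (fun=> m) r.
    rewrite -!dotBl//; try exact: L2_cst; last exact: L2B.
    by congr dot; apply/funext => x; rewrite /r /w; ring.
  by rewrite E3 subr0 -[dot v r](addrK (dot f h)) E1 -[dot F r](addrK (dot f h)) E2 subrr.
have hc x : h x = h 0.
  have [y /andP[y0 y1] ->] := periodic_reduce Hh.1 x.
  apply/eqP; rewrite -subr_eq0 -normr_le0 hr.
  by rewrite -[leRHS]r0; apply: sint_norm_le_norm2 => //; exact: ltW.
have zE : z = fun x => h 0 + P x.
  by apply/funext => x; rewrite -(hc x) /h /=; ring.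
exists w => x.
  rewrite zE -[w x]add0r; apply: is_deriveD; exact: dP.
rewrite -[f x]addr0; apply: is_deriveD; exact: dF.
Qed.

End EulerLagrange.

(** * First-order expansion of the functional *)

Section Expansion.
Context {R : realType}.
Implicit Types (F G : pair_fun R -> R) (z h : pair_fun R) (e d : R).

Definition pair_add z h : pair_fun R := (z.1 \+ h.1, z.2 \+ h.2).

(** A first-order expansion with a bounded [L], which the chain rule needs. Unlike in
    [has_differential], the perturbed pair ranges over all of H^1, so the pieces of the functional
    can be expanded separately. *)
Definition expands F z (L : pair_fun R -> R) : Prop :=
  (exists C, forall h, H1pair h -> `|L h| <= C * H1norm h) /\
  forall e, 0 < e -> exists2 d, 0 < d &
    forall h, H1pair h -> H1norm h < d -> `|F (pair_add z h) - F z - L h| <= e * H1norm h.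

Lemma H1norm_ge0 h : 0 <= H1norm h.
Proof. exact: sqrtr_ge0. Qed.

Lemma expands_has_differential F z L : expands F z L -> has_differential F z L.
Proof.
by move=> [_ H] e e0; have [d d0 Hd] := H e e0; exists d => // h Hh _; exact: Hd.
Qed.

Lemma expands_bound F z L : expands F z L -> exists2 C, 0 < C &
  exists2 d, 0 < d & forall h, H1pair h -> H1norm h < d ->
    `|F (pair_add z h) - F z| <= C * H1norm h.
Proof.
move=> [[C HC] H]; have [d d0 Hd] := H 1 ltr01.
exists (`|C| + 1); first by rewrite ltr_wpDl.
exists d => // h Hh hd.
have -> : F (pair_add z h) - F z = L h + (F (pair_add z h) - F z - L h) by ring.
apply: le_trans (ler_normD _ _) _; rewrite mulrDl lerD ?Hd//.
apply: le_trans (HC h Hh) _; rewrite ler_wpM2r ?H1norm_ge0//; exact: ler_norm.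
Qed.

Lemma expands_quadratic F z L C K : (forall h, H1pair h -> `|L h| <= C * H1norm h) ->
  (forall h, H1pair h -> H1norm h <= 1 ->
     `|F (pair_add z h) - F z - L h| <= K * H1norm h ^+ 2) -> expands F z L.
Proof.
move=> HC HK; split; first by exists C.
move=> e e0; exists (Num.min 1 (e / (`|K| + 1))).
  by rewrite lt_min ltr01 divr_gt0// ltr_wpDl.
move=> h Hh; rewrite lt_min => /andP[h1 h2]; apply: le_trans (HK h Hh (ltW h1)) _.
rewrite expr2 mulrA ler_wpM2r ?H1norm_ge0//.
have K1 : 0 < `|K| + 1 by rewrite ltr_wpDl.
move: h2; rewrite ltr_pdivlMr// => /ltW; apply: le_trans.
rewrite mulrC ler_wpM2l ?H1norm_ge0//.
by have := ler_norm K; lra.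
Qed.

Lemma expands_add F G z L M : expands F z L -> expands G z M ->
  expands (fun y => F y + G y) z (fun h => L h + M h).
Proof.
move=> [[C HC] HF] [[D HD] HG]; split.
  exists (C + D) => h Hh; apply: le_trans (ler_normD _ _) _.
  by rewrite mulrDl lerD ?HC ?HD.
move=> e e0; have e2 : 0 < e / 2 by lra.
have [d d0 Hd] := HF _ e2; have [d' d'0 Hd'] := HG _ e2.
exists (Num.min d d'); first by rewrite lt_min d0.
move=> h Hh; rewrite lt_min => /andP[h1 h2].
have -> : F (pair_add z h) + G (pair_add z h) - (F z + G z) - (L h + M h) =
  (F (pair_add z h) - F z - L h) + (G (pair_add z h) - G z - M h) by ring.
apply: le_trans (ler_normD _ _) _.
have := Hd h Hh h1; have := Hd' h Hh h2; lra.
Qed.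

Lemma expands_comp F z L (phi : R -> R) (l : R) : expands F z L ->
  is_derive (F z) (1 : R) phi l -> expands (fun y => phi (F y)) z (fun h => l * L h).
Proof.
move=> EF /is_derive1_caratheodory[g [phiE cg gE]]; have [C C0 [d1 d10 HC]] := expands_bound EF.
have [[D HD] HF] := EF; split.
  exists (`|l| * D) => h Hh; rewrite normrM -mulrA ler_wpM2l//; exact: HD.
move=> e e0.
(* Half of [e] is spent on the remainder of [phi], for increments of size at most [C * H1norm h],
   the other half on the remainder of [F] multiplied by [l]. *)
have [d2 d20 Hphi] : exists2 d2, 0 < d2 & forall y, `|y - F z| < d2 ->
    `|phi y - phi (F z) - l * (y - F z)| <= e / (2 * C) * `|y - F z|.
  have eC : 0 < e / (2 * C) by rewrite divr_gt0// mulr_gt0.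
  move: cg => /cvgrPdist_lt/(_ _ eC)[d2 /= d20 Hd2]; exists d2 => // y yd.
  rewrite phiE -mulrBl normrM ler_wpM2r// -gE distrC; apply/ltW/Hd2.
  by rewrite /= distrC.
have e1 : 0 < e / (2 * (`|l| + 1)) by rewrite divr_gt0// mulr_gt0// ltr_wpDl.
have [d3 d30 H3] := HF _ e1.
exists (Num.min d1 (Num.min d3 (d2 / C))).
  by rewrite !lt_min d10 d30 divr_gt0.
move=> h Hh; rewrite !lt_min => /and3P[h1 h2 h3].
have N0 := H1norm_ge0 h.
have B := HC h Hh h1.
set y := F (pair_add z h) in B *.
have yd : `|y - F z| < d2.
  by apply: le_lt_trans B _; rewrite mulrC -ltr_pdivlMr.
have -> : phi y - phi (F z) - l * L h =
  (phi y - phi (F z) - l * (y - F z)) + l * (y - F z - L h) by ring.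
apply: le_trans (ler_normD _ _) _.
have A1 : `|phi y - phi (F z) - l * (y - F z)| <= e / 2 * H1norm h.
  apply: le_trans (Hphi y yd) _.
  apply: le_trans (ler_wpM2l _ B) _; first by rewrite divr_ge0//; lra.
  by rewrite le_eqVlt; apply/orP; left; apply/eqP; field; lra.
have A2 : `|l * (y - F z - L h)| <= e / 2 * H1norm h.
  rewrite normrM; apply: le_trans (ler_wpM2l _ (H3 h Hh h2)) _ => //.
  rewrite mulrA ler_wpM2r// mulrA ler_pdivrMr; last by rewrite mulr_gt0// ltr_wpDl.
  have := normr_ge0 l; nra.
lra.
Qed.

Lemma expands_ext F G z L M : F =1 G -> L =1 M -> expands F z L -> expands G z M.
Proof. by move=> /funext<- /funext<-. Qed.

Lemma expands_scale k F z L : expands F z L -> expands (fun y => k * F y) z (fun h => k * L h).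
Proof.
move=> EF; apply: (@expands_comp F z L (fun x => k * x) k) => //.
have : is_derive (F z) (1 : R) (fun x : R => k *: x) (k *: 1) by exact: is_deriveZ.
by rewrite /GRing.scale/= mulr1.
Qed.

(** Polarization: [F G = ((F + G)^2 - F^2 - G^2) / 2] reduces products to the chain rule for the
    square. *)
Lemma expands_mul F G z L M : expands F z L -> expands G z M ->
  expands (fun y => F y * G y) z (fun h => F z * M h + G z * L h).
Proof.
have sq H N : expands H z N -> expands (fun y => H y * H y) z (fun h => 2 * H z * N h).
  move=> EH; apply: (@expands_comp H z N (fun x => x * x) (2 * H z)) => //.
  rewrite [2 * _](_ : _ = H z *: 1 + H z *: 1); first exact: is_deriveM.
  by rewrite /GRing.scale/=; ring.
move=> EF EG.
have := expands_add (sq _ _ (expands_add EF EG))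
   (expands_add (expands_scale (- 1) (sq _ _ EF)) (expands_scale (- 1) (sq _ _ EG))).
move=> /(expands_scale (2^-1)); by apply: expands_ext => h /=; field.
Qed.

Lemma expands_inv F z L : F z != 0 -> expands F z L ->
  expands (fun y => (F y)^-1) z (fun h => - (F z) ^- 2 * L h).
Proof.
move=> F0 EF; apply: (@expands_comp F z L (fun x => x^-1) (- (F z) ^- 2)) => //.
have := @is_deriveV R id (F z) 1 1 F0; rewrite /GRing.scale/= mulr1; apply; exact: is_derive_id.
Qed.

End Expansion.

(** * Expansion of the mass, the kinetic term and the quartic term *)

Section FunctionalExpansion.
Context {R : realType}.
Implicit Types (F G : pair_fun R -> R) (z h : pair_fun R) (e d : R) (u v w : R -> R).

Lemma H1norm_sqr h : H1norm h ^+ 2 = norm2 h.1 ^+ 2 + norm2 (wderiv h.1) ^+ 2 +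
  norm2 h.2 ^+ 2 + norm2 (wderiv h.2) ^+ 2.
Proof. by rewrite sqr_sqrtr// !addr_ge0 ?sqr_ge0. Qed.

(** What the two projections have in common, so that each expansion is proved once for both. *)
Definition component (p : pair_fun R -> R -> R) := [/\ forall z h, p (pair_add z h) = p z \+ p
  h,
  forall h, H1pair h -> H1 (p h), forall h, norm2 (p h) <= H1norm h &
  forall h, norm2 (wderiv (p h)) <= H1norm h].

Let le_sqr (x y : R) : 0 <= y -> x ^+ 2 <= y ^+ 2 -> x <= y.
Proof.
move=> y0; have [x0|x0 _] := leP 0 x; last by rewrite ltW// (lt_le_trans x0).
by rewrite ler_pXn2r.
Qed.

Lemma component1 : component fst.
Proof.
split=> [//|h []//|h|h]; apply: le_sqr; rewrite ?H1norm_ge0// H1norm_sqr;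
 have := sqr_ge0 (norm2 h.1); have := sqr_ge0 (norm2 h.2);
 have := sqr_ge0 (norm2 (wderiv h.1)); have := sqr_ge0 (norm2 (wderiv h.2)); lra.
Qed.

Lemma component2 : component snd.
Proof.
split=> [//|h []//|h|h]; apply: le_sqr; rewrite ?H1norm_ge0// H1norm_sqr;
 have := sqr_ge0 (norm2 h.1); have := sqr_ge0 (norm2 h.2);
 have := sqr_ge0 (norm2 (wderiv h.1)); have := sqr_ge0 (norm2 (wderiv h.2)); lra.
Qed.

Lemma norm2_sqrD u v : L2_circle u -> L2_circle v ->
  norm2 (fun x => u x + v x) ^+ 2 = norm2 u ^+ 2 + 2 * dot u v + norm2 v ^+ 2.
Proof.
move=> Lu Lv; have Luv := L2D Lu Lv; rewrite !norm2_sqr dotDl// !dotDr//.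
by rewrite (dotC v u); ring.
Qed.

Lemma norm2_sqr_wderiv u v : is_weak_derivative u v -> norm2 (wderiv u) ^+ 2 = norm2 v ^+ 2.
Proof. by move=> uv; rewrite !norm2_sqr (dot_wderiv2 uv). Qed.

Lemma dot_bound_l u v (N : R) : L2_circle u -> L2_circle v -> norm2 v <= N ->
  `|dot u v| <= norm2 u * N.
Proof.
move=> Lu Lv vN; apply: le_trans (cauchy_schwarz Lu Lv) _.
by rewrite ler_wpM2l ?norm2_ge0.
Qed.

Section Component.
Variables (p : pair_fun R -> R -> R) (z : pair_fun R).
Hypotheses (Hp : component p) (Hz : H1pair z).

Lemma expands_mass : expands (fun y => norm2 (p y) ^+ 2) z (fun h => 2 * dot (p z) (p h)).
Proof.
case: Hp => pD pH pn pk.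
have Lz := H1_L2 (pH _ Hz).
apply: (@expands_quadratic _ _ _ _ (2 * norm2 (p z)) 1) => h Hh; have Lh := H1_L2 (pH _ Hh).
  by rewrite normrM ger0_norm// -mulrA ler_wpM2l// dot_bound_l.
move=> _; rewrite pD /= norm2_sqrD//.
rewrite [X in `|X|](_ : _ = norm2 (p h) ^+ 2); last by ring.
by rewrite mul1r ger0_norm ?sqr_ge0// ler_pXn2r ?nnegrE ?norm2_ge0 ?H1norm_ge0.
Qed.

Lemma expands_kinetic : expands (fun y => norm2 (wderiv (p y)) ^+ 2) z
  (fun h => 2 * dot (wderiv (p z)) (wderiv (p h))).
Proof.
case: Hp => pD pH pn pk.
have zv := wderivP (pH _ Hz); have Lz := zv.1.
apply: (@expands_quadratic _ _ _ _ (2 * norm2 (wderiv (p z))) 1) => h Hh;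
  have hv := wderivP (pH _ Hh); have Lh := hv.1.
  by rewrite normrM ger0_norm// -mulrA ler_wpM2l// dot_bound_l.
move=> _; rewrite pD (norm2_sqr_wderiv (weak_derivativeD zv hv)) norm2_sqrD//.
rewrite [X in `|X|](_ : _ = norm2 (wderiv (p h)) ^+ 2); last by ring.
by rewrite mul1r ger0_norm ?sqr_ge0// ler_pXn2r ?nnegrE ?norm2_ge0 ?H1norm_ge0.
Qed.

Lemma expands_quartic : expands (fun y => norm2 (fun t => p y t ^+ 2) ^+ 2) z
  (fun h => 4 * dot (fun t => p z t ^+ 3) (p h)).
Proof.
case: Hp => pD pH pn pk.
have Hu := pH _ Hz; set u := p z in Hu *.
have cu := H1_continuous Hu.
have cX f n : continuous (f : R -> R) -> continuous (fun t => f t ^+ n).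
  by move=> cf; elim: n => [|n IH]; [exact: continuous_cst|under eq_fun do rewrite exprS;
    exact: continuous_mul].
have pX f n : periodic f 1 -> periodic (fun t => (f t : R) ^+ n) 1 by move=> pf t; rewrite pf.
have Lu3 : L2_circle (fun t => u t ^+ 3).
  by apply: L2_continuous; [apply: pX; case: Hu|exact: cX].
pose M := norm2 u + norm2 (wderiv u).
have uM x : `|u x| <= M by exact: H1_sup_le.
have M0 : 0 <= M by rewrite addr_ge0 ?norm2_ge0.
(* The second constant bounds [6 u^2 + 4 u k + k^2], the cofactor of [k^2] in the expansion of
   [(u + k)^4], for [|u| <= M] and [|k| <= 2]; the latter holds as soon as [H1norm h <= 1]. *)
apply: (@expands_quadratic _ _ _ _ (4 * norm2 (fun t => u t ^+ 3)) (6 * M ^+ 2 + 8 * M + 4)).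
  by move=> h Hh; rewrite normrM ger0_norm// -mulrA ler_wpM2l// dot_bound_l//;
    exact: H1_L2 (pH _ Hh).
move=> h Hh hN; have Hk := pH _ Hh; set k := p h in Hk *; have ck := H1_continuous Hk.
have k2 x : `|k x| <= 2.
  by apply: le_trans (H1_sup_le Hk x) _; have := pn h; have := pk h; rewrite -/k; lra.
rewrite pD -/u -/k !norm2_sqr !dotE /=.
pose g t := 6 * u t ^+ 2 + 4 * (u t * k t) + k t ^+ 2.
have cg : continuous g.
  apply: (@continuous_add _ (fun t => 6 * u t ^+ 2 + 4 * (u t * k t))); last exact: cX.
  apply: (@continuous_add _ (fun t => 6 * u t ^+ 2) (fun t => 4 * (u t * k t))).
    exact: continuous_scale (cX _ _ _).
  exact: continuous_scale (continuous_mul _ _).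
have -> : (fun x => (u x + k x) ^+ 2 * (u x + k x) ^+ 2) =
  (fun x => (u x ^+ 2 * u x ^+ 2 + 4 * (u x ^+ 3 * k x)) + g x * k x ^+ 2).
  by apply/funext => x; rewrite /g; ring.
have i1 : loc_int (fun x => u x ^+ 2 * u x ^+ 2).
  by apply: loc_int_continuous; apply: continuous_mul; exact: cX.
have i2 : loc_int (fun x => u x ^+ 3 * k x).
  by apply: loc_int_continuous; apply: continuous_mul => //; exact: cX.
have i3 : loc_int (fun x => g x * k x ^+ 2).
  by apply: loc_int_continuous; apply: continuous_mul => //; exact: cX.
have i4 : loc_int (fun x => k x ^+ 2) by apply: loc_int_continuous; exact: cX.
rewrite sintD//; last by apply: loc_intD => //; exact: loc_intZ.
rewrite sintD//; last exact: loc_intZ.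
rewrite sintZ//.
rewrite [X in `|X|](_ : _ = sint 0 1 (fun x => g x * k x ^+ 2)); last by ring.
apply: le_trans (norm_sint_le _ i3) _ => //.
apply: (@le_trans _ _ (sint 0 1 (fun x => (6 * M ^+ 2 + 8 * M + 4) * k x ^+ 2))).
  apply: le_sint => //; [exact: loc_int_norm|exact: loc_intZ|].
  move=> x _; rewrite normrM (ger0_norm (sqr_ge0 _)) ler_wpM2r ?sqr_ge0//.
  have := uM x; have := k2 x; have := normr_ge0 (u x); have := normr_ge0 (k x) => ku uu k2x uMx.
  apply: le_trans (ler_normD _ _) _; apply: lerD.
    apply: le_trans (ler_normD _ _) _; apply: lerD.
      by rewrite normrM ger0_norm// ler_wpM2l// normrX ler_pXn2r ?nnegrE.
    by rewrite normrM ger0_norm// normrM; nra.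
  by rewrite normrX; nra.
rewrite sintZ// ler_wpM2l ?addr_ge0 ?mulr_ge0 ?sqr_ge0//.
have -> : sint 0 1 (fun x => k x ^+ 2) = norm2 k ^+ 2.
  by rewrite norm2_sqr dotE; congr sint; apply/funext => x; rewrite expr2.
by rewrite ler_pXn2r ?nnegrE ?norm2_ge0 ?H1norm_ge0//; exact: pn.
Qed.

End Component.

Lemma norm2Z (k : R) u : L2_circle u -> norm2 (fun x => k * u x) ^+ 2 = k ^+ 2 * norm2 u ^+ 2.
Proof.
move=> Lu; rewrite !norm2_sqr dotZl// ?dotZr//; first by ring.
exact: L2Z.
Qed.

Definition pair_scale (s : R) h : pair_fun R := (fun x => s * h.1 x, fun x => s * h.2 x).

Lemma H1norm_scale (s : R) h : 0 <= s -> H1pair h -> H1norm (pair_scale s h) = s * H1norm h.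
Proof.
move=> s0 Hh; apply/eqP; rewrite -(eqrXn2 (n := 2))// ?mulr_ge0 ?H1norm_ge0//.
have [H1 H2] := Hh.
rewrite exprMn !H1norm_sqr /= !norm2Z ?(norm2_sqr_wderiv (weak_derivativeZ s (wderivP H1)))
 ?(norm2_sqr_wderiv (weak_derivativeZ s (wderivP H2))) ?norm2Z; try exact: H1_L2;
   try exact: wderiv_L2.
by apply/eqP; ring.
Qed.

Lemma H1pair_scale (s : R) h : H1pair h -> H1pair (pair_scale s h).
Proof. by move=> [H1 H2]; split; exact: H1Z. Qed.

(** Along small multiples of [h] both expansions apply, so [L] is small compared with the norm
    there, and homogeneity carries this back to [h]. Since [has_differential] only tests
    perturbations inside [H1av], the multiple must also be small enough to keep both masses
    positive. *)
Lemma expands_zero F z L : H1av z -> expands F z L -> has_differential F z (fun=> 0) ->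
  (forall (s : R) h, H1pair h -> L (pair_scale s h) = s * L h) ->
  forall h, H1pair h -> L h = 0.
Proof.
move=> [Hz z1 z2] [_ EF] DF Ls h Hh; apply/eqP; rewrite -normr_le0.
have N0 := H1norm_ge0 h.
suff S e : 0 < e -> `|L h| <= 2 * e * H1norm h.
  apply/ler_addgt0Pl => e e0; rewrite addr0.
  apply: le_trans (S (e / (2 * (H1norm h + 1))) _) _.
    by rewrite divr_gt0// mulr_gt0// ltr_wpDl.
  have N1 : 0 < H1norm h + 1 by rewrite ltr_wpDl.
  have -> : 2 * (e / (2 * (H1norm h + 1))) * H1norm h = e * H1norm h / (H1norm h + 1).
    by field; rewrite gt_eqF.
  rewrite ler_pdivrMr//.
  by rewrite ler_pM2l//; lra.
move=> e0; have [d1 d10 H1] := EF e e0; have [d2 d20 H2] := DF e e0.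
have [C1 C10 [d3 d30 H3]] := expands_bound (expands_mass component1 Hz).
have [C2 C20 [d4 d40 H4]] := expands_bound (expands_mass component2 Hz).
have a10 : 0 < norm2 z.1 ^+ 2 / C1 by rewrite divr_gt0// exprn_gt0.
have a20 : 0 < norm2 z.2 ^+ 2 / C2 by rewrite divr_gt0// exprn_gt0.
(* Below the last two bounds the change of each mass is smaller than the mass itself. *)
pose d := Num.min (Num.min d1 d2) (Num.min (Num.min d3 d4)
  (Num.min (norm2 z.1 ^+ 2 / C1) (norm2 z.2 ^+ 2 / C2))).
have d0 : 0 < d by rewrite !lt_min d10 d20 d30 d40 a10.
(* The added 1 covers an [h] of norm zero. *)
pose s := d / (H1norm h + 1).
have s0 : 0 < s by rewrite divr_gt0// ltr_wpDl.
pose k := pair_scale s h.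
have Hk : H1pair k by exact: H1pair_scale.
have kN : H1norm k = s * H1norm h by rewrite H1norm_scale// ltW.
have : H1norm k < d.
  rewrite kN /s mulrAC ltr_pdivrMr ?ltr_wpDl//.
  by rewrite ltr_pM2l//; lra.
rewrite !lt_min -!andbA => /and5P[k1 k2 k3 k4 /andP[k5 k6]].
have pos (x y C : R) : 0 < C -> 0 <= y -> `|y ^+ 2 - x ^+ 2| <= C * H1norm k -> H1norm k < x
  ^+ 2 / C -> 0 < y.
  move=> C0 y0; rewrite ltr_pdivlMr// => A B; rewrite lt_neqAle eq_sym y0 andbT.
  apply: contraTneq A => ->; rewrite expr0n/= sub0r normrN (ger0_norm (sqr_ge0 _)) -ltNge.
  by rewrite mulrC.
have kav : H1av (pair_add z k).
  split; first by split; apply: H1D; [exact: Hz.1|exact: Hk.1|exact: Hz.2|exact: Hk.2].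
    by apply: (pos (norm2 z.1) _ C1) => //; [exact: norm2_ge0|exact: H3].
  by apply: (pos (norm2 z.2) _ C2) => //; [exact: norm2_ge0|exact: H4].
have A := H1 k Hk k1; have B := H2 k Hk kav k2.
rewrite -/(pair_add z k) subr0 in B.
have : `|L k| <= 2 * e * H1norm k.
  have -> : L k = (F (pair_add z k) - F z) - (F (pair_add z k) - F z - L k) by ring.
  by apply: le_trans (ler_normB _ _) _; lra.
have LkE : L k = s * L h by exact: Ls.
by rewrite LkE kN normrM (gtr0_norm s0) mulrCA ler_pM2l.
Qed.

End FunctionalExpansion.

(** * Critical points as solutions of the Euler-Lagrange equations *)

Section CriticalPoints.
Context {R : realType}.
Implicit Types (z h : pair_fun R) (c e d : R) (u v w f : R -> R).

Definition mass u : R := norm2 u ^+ 2.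
Definition quart u : R := norm2 (fun t => u t ^+ 2) ^+ 2.

(** The coupling enters only through [c], kept as a parameter so that each component satisfies an
    ordinary differential equation of its own; [w] is the classical derivative of [u]. *)
Definition euler_lagrange c u w : Prop :=
  [/\ periodic u 1, 0 < norm2 u, forall x, is_derive x (1 : R) u (w x) &
    forall x, is_derive x (1 : R) w
      ((mass w / mass u - 1 / mass u ^+ 3 - quart u / (2 * c ^+ 2 * mass u ^+ 3)) * u x
       + 1 / (mass u ^+ 2 * c ^+ 2) * u x ^+ 3)].

(* The sum of the mean values of the two Levi-Civita transforms of [z], see
   [critical_mean_sum]. *)
Definition mean_sum z : R := quart z.1 / mass z.1 + quart z.2 / mass z.2.

(** The contribution of one component to the differential. The last term of [Bav] is
    [- 1 / mean_sum z], so it contributes the differential of [mean_sum] divided by [c ^+ 2]. *)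
Definition Bav_form c u v : R :=
  (4 * mass (wderiv u) - 4 / mass u ^+ 2 - 2 * quart u / (mass u ^+ 2 * c ^+ 2)) * dot u v
  + 4 * mass u * dot (wderiv u) (wderiv v)
  + 4 / (mass u * c ^+ 2) * dot (fun t => u t ^+ 3) v.

Lemma H1_sqr_L2 u n : H1 u -> L2_circle (fun t => u t ^+ n).
Proof.
move=> Hu; apply: L2_continuous; first by move=> x; rewrite (Hu.1 x).
by elim: n => [|n IH]; [exact: continuous_cst|under eq_fun do rewrite exprS;
  apply: continuous_mul => //; exact: H1_continuous].
Qed.

(** Cauchy-Schwarz for [u ^+ 2] against the constant 1 bounds the mass by [norm2 (u ^+ 2)]. *)
Lemma quart_gt0 u : H1 u -> 0 < norm2 u -> 0 < quart u.
Proof.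
move=> Hu u0; have := cauchy_schwarz (H1_sqr_L2 2 Hu) (L2_cst 1).
have -> : dot (fun t => u t ^+ 2) (fun=> 1) = norm2 u ^+ 2.
  by rewrite norm2_sqr; congr mean; apply/funext => x; rewrite mulr1 expr2.
rewrite norm2_cst1 mulr1 ger0_norm ?sqr_ge0// => H.
by rewrite exprn_gt0// (lt_le_trans _ H)// exprn_gt0.
Qed.

Lemma mass_gt0 u : 0 < norm2 u -> 0 < mass u.
Proof. by move=> ?; rewrite exprn_gt0. Qed.

Lemma Bav_expands z : H1av z ->
  expands Bav z (fun h => Bav_form (mean_sum z) z.1 h.1 + Bav_form (mean_sum z) z.2 h.2).
Proof.
move=> [Hz z1 z2].
have A1 := expands_mass component1 Hz; have A2 := expands_mass component2 Hz.
have K1 := expands_kinetic component1 Hz; have K2 := expands_kinetic component2 Hz.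
have Q1 := expands_quartic component1 Hz; have Q2 := expands_quartic component2 Hz.
have a1 := mass_gt0 z1; have a2 := mass_gt0 z2.
have b1 := quart_gt0 Hz.1 z1; have b2 := quart_gt0 Hz.2 z2.
have a1n : mass z.1 != 0 by rewrite gt_eqF.
have a2n : mass z.2 != 0 by rewrite gt_eqF.
have den0 : 0 < quart z.1 * mass z.2 + quart z.2 * mass z.1 by apply: addr_gt0; apply: mulr_gt0.
have den : quart z.1 * mass z.2 + quart z.2 * mass z.1 != 0 by rewrite gt_eqF.
have E := expands_add
  (expands_add
    (expands_add (expands_scale 2 (expands_mul A1 K1)) (expands_scale 2 (expands_inv a1n A1)))
    (expands_add (expands_scale 2 (expands_mul A2 K2)) (expands_scale 2 (expands_inv a2n A2))))
  (expands_scale (- 1) (expands_mul (expands_mul A1 A2)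
     (expands_inv den (expands_add (expands_mul Q1 A2) (expands_mul Q2 A1))))).
move: E; apply: expands_ext => h; first by rewrite /Bav /=; ring.
rewrite /Bav_form /mean_sum /= -!/(quart _) -!/(mass _).
move: (mass z.1) (mass z.2) (quart z.1) (quart z.2) (mass (wderiv z.1)) (mass (wderiv z.2))
  a1n a2n den a1 a2 b1 b2 => m1 m2 q1 q2 k1 k2 a1n a2n den a1 a2 b1 b2.
by field; rewrite a1n a2n den.
Qed.

Lemma dot0r u : dot u (fun=> 0) = 0.
Proof. by rewrite /dot; under eq_fun do rewrite mulr0; rewrite mean_sint sint_cst mul0r. Qed.

Lemma Bav_form0 c u : H1 u -> Bav_form c u (fun=> 0) = 0.
Proof.
move=> Hu; rewrite /Bav_form dotC (dotC (wderiv u)) (dot_wderiv (weak_derivative_cst 0));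
  last exact: wderiv_L2.
by rewrite (dotC (fun=> 0)) (dotC (fun=> 0)) !dot0r; ring.
Qed.

Lemma Bav_formZ c u v (s : R) : H1 u -> H1 v -> Bav_form c u (fun x => s * v x) = s * Bav_form
  c u v.
Proof.
move=> Hu Hv; have Lv := wderiv_L2 Hv; have Lu := wderiv_L2 Hu.
rewrite /Bav_form (dotC (wderiv u)) (dot_wderiv (weak_derivativeZ s (wderivP Hv)))//.
rewrite dotZl// !dotZr//; try exact: H1_L2; last exact: H1_sqr_L2.
by rewrite (dotC (wderiv v)); ring.
Qed.

Lemma mean_sum_gt0 z : H1av z -> 0 < mean_sum z.
Proof.
by move=> [[H1 H2] z1 z2]; rewrite addr_gt0 ?divr_gt0 ?quart_gt0 ?mass_gt0.
Qed.

(** Divided by [4 * mass u], the form is [dot u' v' + dot f v] with [f] the right-hand side of the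
    equation; one direction is du Bois-Reymond, the other integration by parts. *)
Lemma Bav_form_eq0 c u : H1 u -> 0 < norm2 u -> 0 < c ->
  (forall v, H1 v -> Bav_form c u v = 0) <-> exists w, euler_lagrange c u w.
Proof.
move=> Hu u0 c0; have a0 := mass_gt0 u0.
have an : mass u != 0 by rewrite gt_eqF.
have cn : c != 0 by rewrite gt_eqF.
pose f k t := (k / mass u - 1 / mass u ^+ 3 - quart u / (2 * c ^+ 2 * mass u ^+ 3)) * u t
       + 1 / (mass u ^+ 2 * c ^+ 2) * u t ^+ 3.
have Lu := H1_L2 Hu; have Lu3 := H1_sqr_L2 3 Hu; have cu := H1_continuous Hu.
have cf k : continuous (f k).
  apply: (@continuous_add _ (fun t => (k / mass u - 1 / mass u ^+ 3 - quart u / (2 * c ^+ 2 *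
    mass u ^+ 3)) * u t)).
    exact: continuous_scale.
  apply: continuous_scale => x; apply: (@continuous_comp _ _ _ u (fun y => y ^+ 3));
    first exact: cu.
  exact: exprn_continuous.
have pf k : periodic (f k) 1 by move=> x; rewrite /f (Hu.1 x).
have formE v : H1 v ->
    Bav_form c u v = 4 * mass u * (dot (wderiv u) (wderiv v) + dot (f (mass (wderiv u))) v).
  move=> Hv; have Lv := H1_L2 Hv.
  rewrite /f dotDl ?dotZl//; try exact: L2Z.
  by rewrite /Bav_form; field; rewrite an cn.
have four : 4 * mass u != 0 by rewrite mulf_neq0// pnatr_eq0.
split.
  move=> H.
  have [v Hv|w dw ddw] := @du_bois_reymond R u (f (mass (wderiv u))) Hu (pf _) (cf _).
    by have /eqP := H v Hv; rewrite formE// mulf_eq0 (negbTE four) /= => /eqP.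
  exists w; split => //; first exact: Hu.1.
  by rewrite /mass -(norm2_sqr_wderiv (C1_weak_derivative Hu.1 (derive_continuous ddw) dw)).
move=> [w [_ _ dw ddw]] v Hv; rewrite formE//.
have -> : mass (wderiv u) = mass w.
  exact: norm2_sqr_wderiv (C1_weak_derivative Hu.1 (derive_continuous ddw) dw).
by rewrite (weak_parts Hu.1 dw ddw (cf _) Hv) mulr0.
Qed.

Lemma euler_lagrange_H1 c u w : euler_lagrange c u w -> H1 u.
Proof.
move=> [pu _ dw ddw]; split=> //; exists w.
exact: C1_weak_derivative pu (derive_continuous ddw) dw.
Qed.

Lemma critical_pointsE z : critical_points z <->
  (exists w, euler_lagrange (mean_sum z) z.1 w) /\ (exists w, euler_lagrange (mean_sum z) z.2
    w).
Proof.
split.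
  move=> [Hz DF]; have E := Bav_expands Hz; have c0 := mean_sum_gt0 Hz.
  have [[H1z H2z] z1 z2] := Hz.
  have L0 := expands_zero Hz E DF.
  have {}L0 h : H1pair h -> Bav_form (mean_sum z) z.1 h.1 + Bav_form (mean_sum z) z.2 h.2 = 0.
    apply: L0 => s {}h [h1 h2]; rewrite /=.
    rewrite (Bav_formZ _ _ H1z h1) (Bav_formZ _ _ H2z h2); ring.
  (* Perturbing one component at a time separates the two equations. *)
  split; apply/Bav_form_eq0 => // v Hv.
    by have := L0 (v, fun=> 0) (conj Hv (H1_cst 0)); rewrite /= Bav_form0 ?addr0.
  by have := L0 (fun=> 0, v) (conj (H1_cst 0) Hv); rewrite /= Bav_form0 ?add0r.
move=> [[w1 E1] [w2 E2]].
have H1z := euler_lagrange_H1 E1; have H2z := euler_lagrange_H1 E2.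
have Hz : H1av z by split; [split|case: E1|case: E2].
have c0 := mean_sum_gt0 Hz; have [_ z1 z2] := Hz.
split=> // e e0; have [d d0 Hd] := expands_has_differential (Bav_expands Hz) e0.
exists d => // h Hh Hzh hd; have := Hd h Hh Hzh hd.
have f1 := (Bav_form_eq0 H1z z1 c0).2 (ex_intro _ w1 E1) _ Hh.1.
have f2 := (Bav_form_eq0 H2z z2 c0).2 (ex_intro _ w2 E2) _ Hh.2.
by rewrite f1 f2 addr0.
Qed.

End CriticalPoints.

(** * Order of vanishing and sign *)

Section VanishingOrder.
Context {R : realType}.
Implicit Types (f g k u v w z : R -> R) (a b c x y t : R).

(** The cofactor is only asked to be continuous at [x]: differentiability in Caratheodory's form
    then provides it at a simple zero, and orders add under products. *)
Definition vanishes_to_order g x (m : nat) := exists k : R -> R,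
  [/\ {for x, continuous k}, k x != 0 & forall y, g y = k y * (y - x) ^+ m].

Lemma vanishes_mul f g x m n : vanishes_to_order f x m -> vanishes_to_order g x n ->
  vanishes_to_order (fun y => f y * g y) x (m + n).
Proof.
move=> [k [ck k0 fk]] [l [cl l0 gl]]; exists (fun y => k y * l y); split.
- exact: cvgM.
- by rewrite mulf_neq0.
- by move=> y; rewrite fk gl exprD; ring.
Qed.

Lemma vanishes_order0 g x : {for x, continuous g} -> g x != 0 -> vanishes_to_order g x 0.
Proof. by move=> cg g0; exists g; split=> // y; rewrite mulr1. Qed.

Lemma vanishes_order1 g x l : is_derive x (1 : R) g l -> l != 0 -> g x = 0 ->
  vanishes_to_order g x 1.
Proof.
move=> /is_derive1_caratheodory[k [gk ck kx]] l0 gx; exists k; split=> //.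
  by rewrite kx.
by move=> y; rewrite -gk gx subr0.
Qed.

Lemma vanishes_sign g x m : vanishes_to_order g x m -> exists2 s : R, s = 1 \/ s = -1 &
  \forall y \near x^', 0 < s * (y - x) ^+ m * g y.
Proof.
move=> [k [ck k0 gk]].
have H (s : R) : 0 < s * k x -> \forall y \near x^', 0 < s * (y - x) ^+ m * g y.
  move=> skx; have : \forall y \near x, 0 < s * k y.
    have ckx : s * k y @[y --> x] --> s * k x by apply: cvgMr; exact: ck.
    exact: (cvgr_gt _ ckx _ skx).
  move=> /nbhs_dnbhs; apply: filterS2 (nbhs_dnbhs_neq x) => y yx sk.
  rewrite gk [ltRHS](_ : _ = s * k y * ((y - x) ^+ m) ^+ 2); last by ring.
  rewrite mulr_gt0// lt_neqAle sqr_ge0 andbT eq_sym sqrf_eq0 expf_eq0 negb_and.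
  by rewrite subr_eq0 yx orbT.
have [kx|kx|/eqP] := ltgtP (k x) 0; last by rewrite (negbTE k0).
- by exists (- 1); [right|apply: H; lra].
- by exists 1; [left|apply: H; lra].
Qed.

Lemma vanishes_neq0 g x m : vanishes_to_order g x m -> \forall y \near x^', g y != 0.
Proof.
move=> /vanishes_sign[s _]; apply: filterS => y; apply: contraTneq => ->.
by rewrite mulr0 ltxx.
Qed.

Lemma vanishes_continuous g x m : vanishes_to_order g x m -> {for x, continuous g}.
Proof.
move=> [k [ck _ gk]]; rewrite (funext gk); apply: cvgM; first exact: ck.
apply: (@continuous_comp _ _ _ (fun y => y - x) (fun y => y ^+ m));
  last exact: exprn_continuous.
by apply: cvgB; [exact: cvg_id|exact: cvg_cst].
Qed.

Lemma dnbhs_gt0_ge0 g : continuous g -> (forall x, \forall y \near x^', 0 < g y) ->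
  forall x, 0 <= g x.
Proof.
move=> cg H x; rewrite leNgt; apply/negP => gx.
have : \forall y \near x^', False.
  apply: filterS2 (H x) (nbhs_dnbhs (cvgr_lt _ (cg x) _ gx)) => y h1 h2.
  by move: (lt_trans h1 h2); rewrite ltxx.
by move/filter_ex => [].
Qed.

(** The points with positive and those with negative punctured neighbourhoods form two disjoint open
    sets covering the line, which is connected. *)
Lemma dnbhs_sign_global g :
  (forall x, (\forall y \near x^', 0 < g y) \/ (\forall y \near x^', g y < 0)) ->
  (forall x, \forall y \near x^', 0 < g y) \/ (forall x, \forall y \near x^', g y < 0).
Proof.
move=> H.
pose P := [set x : R | \forall y \near x^', 0 < g y].
have op (h : R -> R) : open [set x : R | \forall y \near x^', 0 < h y].
  rewrite openE => x [d /= d0 Hd].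
  exists d => //= y xy.
  have [-> //|yx] := eqVneq y x; first by exists d.
  (* Near [y] the point [x] has to be avoided, since the sign of [h] at [x] itself is unknown. *)
  near=> u; apply: Hd.
  - near: u; apply: nbhs_dnbhs; exists (d - `|x - y|) => /=; first by rewrite subr_gt0.
    move=> u /= yu; rewrite (le_lt_trans (ler_distD y _ _))//; lra.
  - near: u; apply: nbhs_dnbhs.
    by apply: (@open_nbhs_nbhs _ y); split; [exact: open_neq|].
have oP : open P by exact: op.
have oN : open [set x : R | \forall y \near x^', g y < 0].
  by have := op (\- g); congr (open _); apply/seteqP; split => x /=; apply: filterS => y;
    rewrite oppr_gt0.
have PN : P = ~` [set x : R | \forall y \near x^', g y < 0].
  apply/seteqP; split => x /=; last by move=> h; case: (H x).
  move=> px nx.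
  have : \forall y \near x^', False.
    by apply: filterS2 px nx => y h1 h2; move: (lt_trans h1 h2); rewrite ltxx.
  by move/filter_ex => [].
have [[x Px]|P0] := pselect (P !=set0).
  left; have cT : connected [set: R] by apply/connected_intervalP.
  have PT : P = setT.
    apply: cT; [by exists x|by exists P; rewrite ?setTI|].
    by exists P; rewrite ?setTI// PN; exact: open_closedC.
  by move=> y; have : P y by rewrite PT.
right=> x; case: (H x) => // px; exfalso; apply: P0; by exists x.
Unshelve. all: by end_near. Qed.

(** An even power of [y - x] is positive on both sides of [x], so the sign does not change there. *)
Lemma even_order_sign g (m : R -> nat) : (forall x, vanishes_to_order g x (m x)) ->
  (forall x, ~~ odd (m x)) ->
  (forall x, \forall y \near x^', 0 < g y) \/ (forall x, \forall y \near x^', g y < 0).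
Proof.
move=> gm me; apply: dnbhs_sign_global => x.
have [s sP H] := vanishes_sign (gm x).
have E : \forall y \near x^', 0 < (y - x) ^+ m x.
  near=> y; rewrite -(odd_double_half (m x)) (negbTE (me x)) add0n -mul2n exprM.
  rewrite exprn_gt0// lt_neqAle sqr_ge0 andbT eq_sym sqrf_eq0 subr_eq0.
  by near: y; exact: nbhs_dnbhs_neq.
case: sP H => -> H; [left|right]; apply: filterS2 E H => y e0.
  by rewrite mul1r pmulr_rgt0.
by rewrite -mulrA mulN1r oppr_gt0 pmulr_rlt0.
Unshelve. all: by end_near. Qed.

Lemma sinpi_eq0 x : 0 <= x < 1 -> sin (pi * x) = 0 -> x = 0.
Proof.
move=> /andP[x0 x1] s0; apply/eqP; rewrite eq_le x0 andbT leNgt; apply/negP => xp.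
have pp := pi_gt0 R.
have : 0 < sin (pi * x).
  by apply: sin_gt0_pi; rewrite ?in_itv/=; apply/andP; split;
    [rewrite mulr_gt0|rewrite gtr_pMr].
by rewrite s0 ltxx.
Qed.

Lemma sinpi_shift x (k : int) : (sin (pi * (x + k%:~R)) == 0 :> R) = (sin (pi * x) == 0).
Proof.
have H y (n : nat) : (sin (pi * (y + n%:R)) == 0 :> R) = (sin (pi * y) == 0).
  elim: n => [|n IH]; first by rewrite addr0.
  by rewrite -natr1 addrA mulrDr mulr1 sinDpi oppr_eq0.
case: k => n; first by rewrite -pmulrn H.
by rewrite NegzE mulrNz -pmulrn -[LHS](H _ n.+1) subrK.
Qed.

(* Simple zeros exactly at the points of [s + Z], and multiplied by
   [(-1)^(size s)] under [x -> x + 1]: it prescribes the sign changes of [z]. *)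
Definition sinpi_prod (s : seq R) x : R := \prod_(t <- s) sin (pi * (x - t)).

Definition circle_frac x : R := x - (Num.floor x)%:~R.

Lemma circle_frac_itv x : 0 <= circle_frac x < 1.
Proof. by rewrite /circle_frac; have := floor_itv x; rewrite intrD => /andP[? ?]; apply/andP;
  split; lra. Qed.

Lemma periodic_circle_frac f : periodic f 1 -> forall x, f (circle_frac x) = f x.
Proof. by move=> pf x; rewrite -[LHS](periodic_int (Num.floor x) pf) subrK. Qed.

Lemma sinpi_sub_eq0 x t : 0 <= t < 1 -> (sin (pi * (x - t)) == 0) = (t == circle_frac x).
Proof.
move=> /andP[t0 t1]; have /andP[f0 f1] := circle_frac_itv x.
have -> : x - t = (circle_frac x - t) + (Num.floor x)%:~R by rewrite /circle_frac; ring.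
rewrite sinpi_shift; apply/eqP/eqP => [|->]; last by rewrite subrr mulr0 sin0.
have [tx|xt] := leP t (circle_frac x).
  move=> /sinpi_eq0 H; apply/eqP; rewrite eq_sym -subr_eq0; apply/eqP/H; lra.
move=> s0; have : sin (pi * (t - circle_frac x)) = 0.
  by rewrite -opprB mulrN sinN s0 oppr0.
move=> /sinpi_eq0 H; apply/eqP; rewrite -subr_eq0; apply/eqP/H; lra.
Qed.

Lemma is_derive_sinpi x t : is_derive x (1 : R) (fun y => sin (pi * (y - t))) (pi * cos (pi *
  (x - t))).
Proof.
have D : is_derive x (1 : R) (fun y : R => pi * (y - t)) (pi *: (1 - 0) : R).
  by apply: is_deriveZ; apply: is_deriveB.
have := is_derive1_comp (f := sin) (g := fun y => pi * (y - t)) (is_derive_sin _) D.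
by rewrite subr0 /GRing.scale/= mulr1 mulrC; exact.
Qed.

Lemma sinpi_prod_order (s : seq R) x :
  vanishes_to_order (sinpi_prod s) x (count (fun t => sin (pi * (x - t)) == 0) s).
Proof.
elim: s => [|t s IH].
  rewrite /sinpi_prod; under eq_fun do rewrite big_nil.
  by apply: vanishes_order0; rewrite ?oner_eq0//; exact: cvg_cst.
rewrite /sinpi_prod; under eq_fun do rewrite big_cons.
apply: vanishes_mul IH => /=.
have D := is_derive_sinpi x t.
have [s0|s0] /= := eqVneq (sin (pi * (x - t))) 0.
  apply: (vanishes_order1 D) => //; rewrite mulf_neq0 ?(gt_eqF (pi_gt0 R))//.
  apply/eqP => c0; have := cos2Dsin2 (pi * (x - t)); rewrite c0 s0 expr0n/= addr0.
  by move/eqP; rewrite eq_sym oner_eq0.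
apply: vanishes_order0 => //; apply/differentiable_continuous/derivable1_diffP.
by case: D.
Qed.

Lemma sinpi_prod_orderE (s : seq R) x : uniq s -> (forall t, t \in s -> 0 <= t < 1) ->
  vanishes_to_order (sinpi_prod s) x (circle_frac x \in s).
Proof.
move=> us s01; rewrite -count_uniq_mem//.
rewrite -(@eq_in_count _ (fun t => sin (pi * (x - t)) == 0)); first exact: sinpi_prod_order.
by move=> t /s01; exact: sinpi_sub_eq0.
Qed.

Lemma sinpi_prod_period (s : seq R) x : sinpi_prod s (x + 1) = (- 1) ^+ size s * sinpi_prod s x.
Proof.
rewrite /sinpi_prod; elim: s => [|t s IH]; first by rewrite !big_nil mulr1.
rewrite !big_cons IH [size _]/= exprS addrAC mulrDr mulr1 sinDpi; ring.
Qed.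

(** The product of [z] and [sinpi_prod s], whose simple zeros lie at the same points, has even order
    everywhere, hence constant sign. Were the number of zeros odd, it would be negated by
    [x -> x + 1] and so vanish identically, although it is nonzero off isolated points. *)
Lemma even_simple_zeros z w (s : seq R) : periodic z 1 ->
  (forall x, is_derive x (1 : R) z (w x)) -> (forall x, z x = 0 -> w x != 0) ->
  uniq s -> zeros z = [set` s] -> ~~ odd (size s).
Proof.
move=> pz dz zw us zs.
have s01 t : t \in s -> 0 <= t < 1.
  by move=> ts; have [] : zeros z t by rewrite zs.
have zsx x : (z x == 0) = (circle_frac x \in s).
  apply/eqP/idP => [zx|xs].
    by have : zeros z (circle_frac x); [split;
      [exact: circle_frac_itv|rewrite periodic_circle_frac]|rewrite zs].
  have [_] : zeros z (circle_frac x) by rewrite zs.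
  by rewrite periodic_circle_frac.
have cz : continuous z := derive_continuous dz.
have oz x : vanishes_to_order z x (circle_frac x \in s).
  rewrite -zsx; have [zx|zx] := eqVneq (z x) 0.
    exact: vanishes_order1 (dz x) (zw _ zx) zx.
  by apply: vanishes_order0; [exact: cz|].
pose g x := z x * sinpi_prod s x.
have og x : vanishes_to_order g x ((circle_frac x \in s) + (circle_frac x \in s)).
  by apply: vanishes_mul => //; exact: sinpi_prod_orderE.
have ng x : ~~ odd ((circle_frac x \in s) + (circle_frac x \in s)) by rewrite oddD addbb.
apply/negP => so.
have gN x : g (x + 1) = - g x.
  by rewrite /g pz sinpi_prod_period -signr_odd so expr1; ring.
have cg : continuous g by move=> x; exact: vanishes_continuous (og x).
have zero (h : R -> R) : (forall x, h (x + 1) = - h x) -> (forall x, 0 <= h x) -> h = fun=> 0.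
  by move=> hN h0; apply/funext => x; have := h0 x; have := h0 (x + 1); rewrite hN; lra.
have [H|H] := even_order_sign og ng.
- have := H 0; rewrite (zero g gN (dnbhs_gt0_ge0 cg H)).
  by under eq_near do rewrite ltxx; move/filter_ex => [].
- have gN' x : (\- g) (x + 1) = - (\- g) x by rewrite /= gN.
  have H' x : \forall y \near x^', 0 < (\- g) y.
    by apply: filterS (H x) => y; rewrite oppr_gt0.
  have cg' : continuous (\- g) by move=> x; apply: cvgN; exact: cg.
  have := H' 0; rewrite (zero (\- g) gN' (dnbhs_gt0_ge0 cg' H')).
  by under eq_near do rewrite ltxx; move/filter_ex => [].
Qed.

End VanishingOrder.

(** * Time changes of the circle *)

Section CircleLift.
Context {R : realType}.
Implicit Types (f g F G u v w z : R -> R) (a b c x y t : R).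

(** If [G a = G b], monotonicity makes [G] constant in between, against the positive derivative at a
    regular point just to the right of [a]. *)
Lemma punctured_increasing G g : continuous G ->
  (forall x, \forall y \near x^', is_derive y (1 : R) G (g y) /\ 0 < g y) ->
  forall a b, a < b -> G a < G b.
Proof.
move=> cG dG a b ab.
have nd : forall x y, x <= y -> G x <= G y.
  by apply: (@punctured_nondecreasing R G g cG) => x; apply: filterS (dG x) => y [? /ltW].
rewrite lt_neqAle nd ?ltW// andbT; apply/eqP => E.
have [d d0 Hd] := punctured_ball (dG a).
pose e := Num.min d (b - a).
have e0 : 0 < e by rewrite lt_min d0 subr_gt0.
have ed : e <= d by rewrite ge_min lexx.
have eb : e <= b - a by rewrite ge_min lexx orbT.
pose y := a + e / 2.
have [dy gy] : is_derive y (1 : R) G (g y) /\ 0 < g y.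
  by apply: Hd; rewrite /y ?gt_eqF ?ger0_norm; lra.
have cst : is_derive y (1 : R) G 0.
  have D : is_derive y (1 : R) (fun=> G a) 0 by exact: is_derive_cst.
  apply: near_eq_is_derive D; rewrite ?oner_eq0//.
  near=> u; apply/eqP; rewrite eq_le; apply/andP; split.
    by apply: nd; near: u; apply: filterS (lt_nbhsr (_ : a < y)) => [u /ltW//|]; rewrite /y;
      lra.
  by rewrite E; apply: nd; near: u; apply: filterS (lt_nbhsl (_ : y < b)) => [u /ltW//|];
    rewrite /y; lra.
move: gy; have [_ <-] := dy; have [_ ->] := cst; by rewrite ltxx.
Unshelve. all: by end_near. Qed.

(** Bolzano-Weierstrass: infinitely many zeros in a period would accumulate at a point near which
    there are none. *)
Lemma circle_zeros_finite f : (forall x, \forall y \near x^', f y != 0) -> finite_set (zeros f).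
Proof.
move=> H; apply: contrapT => inf.
have bd : bounded_set (zeros f).
  exists 1; split=> // M M1 x [/andP[x0 x1] _] /=; rewrite ger0_norm//.
  exact: ltW (lt_trans x1 M1).
have [a /limit_point_infinite_setP la] := infinite_bounded_limit_point_nonempty inf bd.
have [d d0 Hd] := punctured_ball (H a).
have := la (ball a d) (nbhsx_ballx _ _ d0); apply.
apply: (@sub_finite_set _ _ [set a]); last exact: finite_set1.
move=> y [ya [_ fy]] /=; apply: contrapT => /eqP yna.
have := Hd y yna; rewrite fy eqxx => /(_ _) H0.
suff : false by []. apply: H0.
by move: ya; rewrite /ball/= distrC.
Qed.

Lemma circle_zeros_isolated f : periodic f 1 -> finite_set (zeros f) ->
  forall x, \forall y \near x^', f y != 0.
Proof.
(* Two points of this window are less than 1 apart, so [circle_frac] is injective on it and sends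
   its zeros into a finite set. *)
move=> pf ff x; pose S := [set y | `|y - x| < 2^-1 /\ f y = 0].
have fS : finite_set (S `\ x).
  apply: (@sub_finite_set _ _ S) => [y []//|].
  have inj : {in S &, injective circle_frac}.
    move=> y y' /[!inE] -[yx _] [yx' _] E.
    have : `|y - y'| < 1.
      by have := ler_distD x y y'; rewrite (distrC x); lra.
    have -> : y - y' = (Num.floor y - Num.floor y')%:~R.
      by rewrite intrB -[y in LHS](subrK (Num.floor y)%:~R) -/(circle_frac y) E /circle_frac;
        ring.
    rewrite -intr_norm ltrz1 => k1.
    have k0 : Num.floor y = Num.floor y' by lia.
    by move: E; rewrite /circle_frac k0 => /(congr1 (fun t => t + (Num.floor y')%:~R));
      rewrite !subrK.
  suff [n Hn] : finite_set (circle_frac @` S).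
    by exists n; apply: card_eq_trans Hn; rewrite card_eq_sym; exact: inj_card_eq inj.
  apply: sub_finite_set ff => _ [y [_ fy] <-]; split; first exact: circle_frac_itv.
  by rewrite periodic_circle_frac.
have oS : open (~` (S `\ x)).
  by apply: closed_openC; apply: compact_closed; [exact: Rhausdorff|exact: finite_compact].
have xS : (~` (S `\ x)) x by move=> [_ /=].
have : \forall y \near x, (~` (S `\ x)) y by apply: open_nbhs_nbhs.
move=> /nbhs_dnbhs; have : \forall y \near x^', `|y - x| < 2^-1.
  by apply: nbhs_dnbhs; exists 2^-1 => //= y; rewrite /= distrC.
apply: filterS3 (nbhs_dnbhs_neq x) => y yx yd nS.
by apply/eqP => fy; apply: nS; split=> //=; exact/eqP.
Qed.

(* [G] and [H] are lifts, fixing 0, of inverse homeomorphisms of the circle. *)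
Record circle_lift G H : Prop := CircleLift {
  lift_fwd : cancel G H;
  lift_bwd : cancel H G;
  lift_homo : forall x y, x < y -> G x < G y;
  lift_cont : continuous G;
  lift_contV : continuous H;
  lift_shift : forall x, G (x + 1) = G x + 1;
  lift_zero : G 0 = 0
}.

Lemma lift_inv G H : circle_lift G H -> circle_lift H G.
Proof.
move=> [fw bw hm cG cH sG zG]; split=> //.
- move=> x y xy; rewrite ltNge; apply/negP; rewrite le_eqVlt => /predU1P[E|/hm].
    by move: xy; rewrite -(bw x) -(bw y) E ltxx.
  by rewrite !bw ltNge (ltW xy).
- by move=> x; apply: (can_inj fw); rewrite sG !bw.
- by apply: (can_inj fw); rewrite bw zG.
Qed.

Lemma lift_int G : (forall x, G (x + 1) = G x + 1) -> G 0 = 0 -> forall n : nat, G n%:R = n%:R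
  /\ G (- n%:R) = - n%:R.
Proof.
move=> sG zG; elim=> [|n [IH1 IH2]]; first by rewrite oppr0.
rewrite -natr1; split; first by rewrite sG IH1.
have := sG (- (n%:R + 1)); rewrite (_ : - (n%:R + 1) + 1 = - n%:R); last by ring.
rewrite IH2; lra.
Qed.

(** [G] fixes every integer, so the intermediate value theorem makes it onto; the inverse is
    continuous because [G] is strictly monotone. *)
Lemma continuous_lift G : continuous G -> (forall x y, x < y -> G x < G y) ->
  (forall x, G (x + 1) = G x + 1) -> G 0 = 0 -> circle_lift G (pinv setT G).
Proof.
move=> cG hm sG zG.
have inj : injective G.
  by move=> x y E; have [/hm|/hm|//] := ltgtP x y; rewrite E ltxx.
have surj t : exists x, G x = t.
  pose n := (Num.trunc `|t|).+1.
  have tn : `|t| < n%:R by exact: truncnS_gt.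
  have [Gn Gmn] := lift_int sG zG n.
  have nn : - n%:R <= n%:R :> R by rewrite lerNl; have := ler0n R n; lra.
  have [||x _ Gx] := @IVT R G (- n%:R) n%:R t nn.
  - exact: continuous_subspaceT.
  - rewrite Gn Gmn min_l// max_r//.
    by move: tn; rewrite ltr_norml => /andP[? ?]; apply/andP; split; exact: ltW.
  - by exists x.
pose H := pinv setT G.
have bw : cancel H G by move=> t; apply: pinvK; rewrite inE; have [x <-] := surj t; exists x.
have fw : cancel G H by move=> x; apply: pinvKV; rewrite ?inE// => ? ? _ _; exact: inj.
split=> //.
have mono x y : (G x < G y) = (x < y).
  by apply/idP/idP => [|/hm//]; rewrite !ltNge; apply: contra;
    rewrite le_eqVlt => /predU1P[->//|/hm/ltW].
move=> t; apply/cvgrPdist_lt => e e0.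
have h1 : G (H t - e) < t by rewrite -[ltRHS]bw mono; lra.
have h2 : t < G (H t + e) by rewrite -[ltLHS]bw mono; lra.
near=> u; rewrite distrC ltr_distl; apply/andP; split.
  by rewrite -mono bw; near: u; exact: lt_nbhsr.
by rewrite -mono bw; near: u; exact: lt_nbhsl.
Unshelve. all: by end_near. Qed.

Lemma lift_is_derive G H x l : circle_lift G H -> is_derive x (1 : R) G l -> l != 0 ->
  is_derive (G x) (1 : R) H l^-1.
Proof.
move=> [fw bw hm cG cH _ _] D l0; apply: (@is_derive_inverse R G H l x) => //.
- by near=> y; exact: fw.
- by near=> y; exact: cG.
Unshelve. all: by end_near. Qed.

Lemma lift_itv G H x : circle_lift G H -> (0 <= G x < 1) = (0 <= x < 1).
Proof.
move=> L; have G1 : G 1 = 1 by have := lift_shift L 0; rewrite !add0r (lift_zero L) add0r.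
have mono (y t : R) : (G y < G t) = (y < t).
  apply/idP/idP => [|/(lift_homo L)//]; rewrite !ltNge; apply: contra.
  by rewrite le_eqVlt => /predU1P[->//|/(lift_homo L)/ltW].
by rewrite -[X in _ < X]G1 mono leNgt -[X in _ < X](lift_zero L) mono -leNgt.
Qed.

(** Carries statements that hold off isolated points from one time scale to the other. *)
Lemma lift_dnbhs G H (P : R -> Prop) x : circle_lift G H ->
  (\forall y \near (G x)^', P y) -> \forall y \near x^', P (G y).
Proof.
move=> L /punctured_ball[d d0 Hd].
have : \forall y \near x, `|G x - G y| < d by have [_ _ _ cG _ _ _] := L;
  move: (cG x) => /cvgrPdist_lt; exact.
move=> /nbhs_dnbhs; apply: filterS2 (nbhs_dnbhs_neq x) => y yx xyd; apply: Hd.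
  by rewrite (can_eq (lift_fwd L)).
by rewrite distrC.
Qed.

End CircleLift.

(** * From critical points to generalized solutions *)

Section DerivativeRules.
Context {R : realType}.
Implicit Types (f g : R -> R) (x a b k : R).

Lemma isder_eq f x a b : is_derive x (1 : R) f a -> a = b -> is_derive x (1 : R) f b.
Proof. by move=> H <-. Qed.

Lemma isder_cst k x : is_derive x (1 : R) (fun _ : R => k) 0.
Proof. exact: is_derive_cst. Qed.

Lemma isder_add f g x a b : is_derive x (1 : R) f a -> is_derive x (1 : R) g b ->
  is_derive x (1 : R) (fun y => f y + g y) (a + b).
Proof. by move=> *; exact: is_deriveD. Qed.

Lemma isder_sub f g x a b : is_derive x (1 : R) f a -> is_derive x (1 : R) g b ->
  is_derive x (1 : R) (fun y => f y - g y) (a - b).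
Proof. by move=> *; exact: is_deriveB. Qed.

Lemma isder_mul f g x a b : is_derive x (1 : R) f a -> is_derive x (1 : R) g b ->
  is_derive x (1 : R) (fun y => f y * g y) (a * g x + f x * b).
Proof.
move=> Df Dg; have : is_derive x (1 : R) (fun y => f y * g y) (f x *: b + g x *: a).
  exact: is_deriveM.
by move=> /isder_eq; apply; rewrite /GRing.scale/=; ring.
Qed.

Lemma isder_scale k f x a : is_derive x (1 : R) f a -> is_derive x (1 : R) (fun y => k * f y)
  (k * a).
Proof. by move=> /(isder_mul (isder_cst k x)) /isder_eq; apply; ring. Qed.

Lemma isder_exp f n x a : is_derive x (1 : R) f a ->
  is_derive x (1 : R) (fun y => f y ^+ n) (n%:R * a * f x ^+ n.-1).
Proof.
move=> Df; elim: n => [|n IH].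
  by rewrite !mul0r; exact: isder_cst.
under eq_fun do rewrite exprS.
apply: isder_eq (isder_mul Df IH) _; case: n {IH} => [|n] /=; first by ring.
by rewrite -[n.+2%:R]natr1 exprS; ring.
Qed.

Lemma isder_inv f x a : f x != 0 -> is_derive x (1 : R) f a ->
  is_derive x (1 : R) (fun y => (f y)^-1) (- a / f x ^+ 2).
Proof.
move=> f0 /(is_deriveV f0) /isder_eq; apply; rewrite /GRing.scale/= mulrC.
by rewrite mulrN mulNr.
Qed.

Lemma isder_comp f g x a b : is_derive (g x) (1 : R) f a -> is_derive x (1 : R) g b ->
  is_derive x (1 : R) (fun y => f (g y)) (a * b).
Proof.
by move=> Df Dg; exact: (is_derive1_comp Df Dg).
Qed.

Lemma isder_near_eq f g x a : is_derive x (1 : R) f a -> (\forall y \near x, f y = g y) ->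
  is_derive x (1 : R) g a.
Proof. by move=> Df fg; apply: near_eq_is_derive Df => //; rewrite oner_eq0. Qed.

Lemma isder_derive1 f x a : is_derive x (1 : R) f a -> derive1 f x = a.
Proof. by move=> [_ <-]; rewrite derive1E. Qed.

Lemma isder_continuous f x a : is_derive x (1 : R) f a -> {for x, continuous f}.
Proof. by move=> [D _]; apply/differentiable_continuous/derivable1_diffP. Qed.

Lemma open_nonzero f x : {for x, continuous f} -> f x != 0 -> \forall y \near x, f y != 0.
Proof.
move=> cf f0; have : nbhs (f x) [set y | y != 0].
  by apply: open_nbhs_nbhs; split; [exact: open_neq|].
by move=> /cf.
Qed.

End DerivativeRules.

(** * The equation of motion off the collisions *)

Section KeplerMotion.
Context {R : realType}.
Implicit Types (q p : R -> R) (c t : R).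

(** Polynomials in [u] and [p]. For [u = 1 / q] and [p] the velocity they are stable under
    derivation along the motion, which gives derivatives of all orders. *)
Inductive rational_in (u p : R -> R) : (R -> R) -> Prop :=
| rational_cst k : rational_in u p (fun=> k)
| rational_u : rational_in u p u
| rational_p : rational_in u p p
| rational_add f g : rational_in u p f -> rational_in u p g -> rational_in u p (fun t => f t +
  g t)
| rational_mul f g : rational_in u p f -> rational_in u p g -> rational_in u p (fun t => f t *
  g t).

(** The equation as a first-order system for [q] and a velocity [p] whose values at the collisions
    are left free. *)
Definition kepler_motion c q p : Prop := forall t, q t != 0 ->
  is_derive t (1 : R) q (p t) /\ is_derive t (1 : R) p (- (2 / q t ^+ 2) + 1 / c ^+ 2).

Lemma rational_in_der c q p f : kepler_motion c q p ->
  rational_in (fun t => (q t)^-1) p f ->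
  exists2 g, rational_in (fun t => (q t)^-1) p g &
    forall t, q t != 0 -> is_derive t (1 : R) f (g t).
Proof.
move=> K; elim=> [k| | |f1 f2 _ [g1 r1 d1] _ [g2 r2 d2]|f1 f2 rf1 [g1 r1 d1] rf2 [g2 r2 d2]].
- by exists (fun=> 0); [exact: rational_cst|move=> t _; exact: isder_cst].
- exists (fun t => (- 1) * (p t * ((q t)^-1 * (q t)^-1))).
    by do !apply: rational_mul;
      [exact: rational_cst|exact: rational_p|exact: rational_u|exact: rational_u].
  move=> t qt; apply: isder_eq (isder_inv qt (K t qt).1) _.
  by rewrite expr2 invfM; ring.
- exists (fun t => (- 2) * ((q t)^-1 * (q t)^-1) + 1 / c ^+ 2).
    apply: rational_add; last exact: rational_cst.
    by do !apply: rational_mul; [exact: rational_cst|exact: rational_u|exact: rational_u].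
  move=> t qt; apply: isder_eq (K t qt).2 _.
  by rewrite [in LHS]expr2 invfM; ring.
- exists (fun t => g1 t + g2 t); first exact: rational_add.
  by move=> t qt; apply: isder_add; [exact: d1|exact: d2].
- exists (fun t => g1 t * f2 t + f1 t * g2 t).
    by apply: rational_add; apply: rational_mul.
  by move=> t qt; apply: isder_mul; [exact: d1|exact: d2].
Qed.

Lemma kepler_motion_solves c q p : continuous q -> kepler_motion c q p -> solves_off_zeros c q.
Proof.
move=> cq K.
have near0 t : q t != 0 -> \forall y \near t, q y != 0 by apply: open_nonzero; exact: cq.
have der1 t : q t != 0 -> derive1 q t = p t by move=> qt; exact: isder_derive1 (K t qt).1.
split; last first.
  move=> t qt; rewrite derive1nS derive1n1.
  apply: isder_derive1; apply: isder_near_eq (K t qt).2 _.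
  by apply: filterS (near0 t qt) => y qy; rewrite der1.
have H n : exists2 f, rational_in (fun t => (q t)^-1) p f & forall t, q t != 0 -> derive1n
  n.+1 q t = f t.
  elim: n => [|n [f rf fE]]; first by exists p; [exact: rational_p|move=> t qt;
    rewrite derive1n1 der1].
  have [g rg gE] := rational_in_der K rf.
  exists g => // t qt; rewrite derive1nS; apply: isder_derive1;
    apply: isder_near_eq (gE t qt) _.
  by apply: filterS (near0 t qt) => y qy; rewrite fE.
case=> [|n] t qt; first by rewrite derive1n0; case: (K t qt) => -[].
have [f rf fE] := H n; have [g rg gE] := rational_in_der K rf.
have [+ _] : is_derive t (1 : R) (derive1n n.+1 q) (g t).
  apply: isder_near_eq (gE t qt) _.
  by apply: filterS (near0 t qt) => y qy; rewrite fE.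
exact.
Qed.

Lemma solves_kepler_motion c q : solves_off_zeros c q -> kepler_motion c q (derive1 q).
Proof.
move=> [D E] t qt; split.
  by apply: DeriveDef; [have := D 0%N t qt|rewrite derive1E].
apply: DeriveDef; first by have := D 1%N t qt; rewrite derive1n1.
by rewrite -(E t qt) derive1nS derive1n1 derive1E.
Qed.

End KeplerMotion.

(** * The regularized equation and its first integral *)

Section Elliptic.
Context {R : realType}.
Implicit Types (u v w z q p : R -> R) (c A x y t : R).

Lemma measurable_invr : measurable_fun setT (fun x : R => x^-1).
Proof.
have -> : setT = ~` [set 0] `|` [set 0] :> set R by rewrite setUC setUv.
apply/measurable_funU; [by apply: measurableC|by []|split; last exact: measurable_fun_set1].
apply: open_continuous_measurable_fun; first by apply: closed_openC; exact: closed_eq.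
by move=> x /[!inE] /= /eqP x0; apply: inv_continuous.
Qed.

Lemma finite_set_enum (S : set R) n : S #= `I_n ->
  exists2 s : seq R, uniq s & size s = n /\ S = [set` s].
Proof.
move=> Sn; have fS : finite_set S by exists n.
exists (finmap.enum_fset (fset_set S)); first exact: finmap.fset_uniq.
split; first exact: card_fset_set.
by rewrite -[LHS](fset_setK fS).
Qed.

Lemma massE u : mass u = sint 0 1 (fun x => u x ^+ 2).
Proof. by rewrite /mass norm2_sqr dotE; congr sint; apply/funext => x; rewrite expr2. Qed.

Lemma quartE u : quart u = sint 0 1 (fun x => u x ^+ 4).
Proof. by rewrite /quart norm2_sqr dotE; congr sint; apply/funext => x; ring. Qed.

Lemma continuous_exp (f : R -> R) n : continuous f -> continuous (fun x => f x ^+ n).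
Proof.
move=> cf x; apply: (@continuous_comp _ _ _ f (fun y => y ^+ n)); first exact: cf.
exact: exprn_continuous.
Qed.

(* The coefficient [A] is left free: the constant of the first integral forces the
   value it has in [euler_lagrange]. *)
Definition elliptic c A z w : Prop :=
  [/\ periodic z 1, 0 < norm2 z,
      forall x, is_derive x (1 : R) z (w x),
      forall x, is_derive x (1 : R) w (A * z x + 1 / (mass z ^+ 2 * c ^+ 2) * z x ^+ 3) &
      forall x, w x ^+ 2 = A * z x ^+ 2 + 1 / (2 * mass z ^+ 2 * c ^+ 2) * z x ^+ 4 + 1 / mass
        z ^+ 2].

(** The average of the first integral over a period; it ties the constant [K] to the linear
    coefficient [A]. *)
Lemma mass_first_integral z w A B K : continuous z ->
  (forall x, w x ^+ 2 = A * z x ^+ 2 + B * z x ^+ 4 + K) -> mass w = A * mass z + B * quart z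
    + K.
Proof.
move=> cz H; rewrite !massE quartE (funext H).
have i2 : loc_int (fun x => z x ^+ 2) by apply: loc_int_continuous; exact: continuous_exp.
have i4 : loc_int (fun x => z x ^+ 4) by apply: loc_int_continuous; exact: continuous_exp.
have iK : loc_int (fun=> K) by apply: loc_int_continuous; exact: continuous_cst.
rewrite (@sintD _ (fun x => A * z x ^+ 2 + B * z x ^+ 4) (fun=> K))//; last first.
  by apply: loc_intD; exact: loc_intZ.
rewrite sintD ?sintZ ?sint_cst ?subr0 ?mulr1//; exact: loc_intZ.
Qed.

(** The equation conserves [G], and averaging determines its value: with the coefficient of
    [euler_lagrange] the kinetic and quartic terms cancel, leaving [1 / mass z ^+ 2]. *)
Lemma euler_lagrange_elliptic c z w : c != 0 ->
  euler_lagrange c z w -> exists A, elliptic c A z w.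
Proof.
move=> c0 [pz z0 dz dw]; have a0 := mass_gt0 z0.
have an : mass z != 0 by rewrite gt_eqF.
set A := _ - _ in dw; exists A; split => //.
set B := 1 / _ in dw.
pose G x := w x ^+ 2 - (A * z x ^+ 2 + B / 2 * z x ^+ 4).
have dG x : is_derive x (1 : R) G 0.
  have := isder_sub (isder_exp 2 (dw x)) (isder_add (isder_scale A (isder_exp 2 (dz x)))
    (isder_scale (B / 2) (isder_exp 4 (dz x)))).
  move=> /isder_eq; apply.
  by rewrite /=; field.
have GC x : G x = G 0.
  by apply: punctured_constant; [exact: derive_continuous dG|move=> u; near=> v; exact: dG].
have FI x : w x ^+ 2 = A * z x ^+ 2 + B / 2 * z x ^+ 4 + G 0.
  by rewrite -(GC x) /G; ring.
have := mass_first_integral (derive_continuous dz) FI.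
rewrite /A /B => E; have -> : 1 / mass z ^+ 2 = G 0.
  move: E; move: (mass w) (G 0) => k g E.
  have -> : g = k - ((k / mass z - 1 / mass z ^+ 3 - quart z / (2 * c ^+ 2 * mass z ^+ 3)) *
    mass z + 1 / (mass z ^+ 2 * c ^+ 2) / 2 * quart z).
    by rewrite [X in X - _]E; ring.
  by field; rewrite an c0.
move=> x; rewrite FI /B /A; congr (_ + _ + _); congr (_ * _).
by field; rewrite an c0.
Unshelve. all: by end_near. Qed.

Lemma elliptic_euler_lagrange c A z w : c != 0 -> elliptic c A z w -> euler_lagrange c z w.
Proof.
move=> c0 [pz z0 dz dw FI]; split=> // x; apply: isder_eq (dw x) _.
have an : mass z != 0 by rewrite gt_eqF// mass_gt0.
rewrite (mass_first_integral (derive_continuous dz) FI); congr (_ * _ + _).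
by field; rewrite an c0.
Qed.

Lemma norm2N u : norm2 (fun x => - u x) = norm2 u.
Proof. by congr Num.sqrt; congr mean; apply/funext => x; rewrite mulrNN. Qed.

Lemma ellipticN c A z w : elliptic c A z w -> elliptic c A (fun x => - z x) (fun x => - w x).
Proof.
move=> [pz z0 dz dw FI].
have mE : mass (fun x => - z x) = mass z.
  by rewrite /mass norm2N.
split.
- by move=> x; rewrite pz.
- by rewrite norm2N.
- by move=> x; apply: is_deriveN.
- move=> x; rewrite mE; apply: isder_eq (is_deriveN (dw x)) _; ring.
- by move=> x; rewrite mE sqrrN FI; ring.
Qed.

End Elliptic.

(** * The Levi-Civita transform of a solution of the regularized equation *)

Section Forward.
Context {R : realType}.
Variables (c A : R) (z w : R -> R).
Hypotheses (c0 : c != 0) (E : elliptic c A z w).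
Local Notation a := (mass z).
Local Notation T := (time_change z).
Local Notation S := (time_change_inv z).
Local Notation q := (levi_civita1 z).

Let pz : periodic z 1. Proof. by case: E. Qed.
Let z0 : 0 < norm2 z. Proof. by case: E. Qed.
Let dz x : is_derive x (1 : R) z (w x). Proof. by case: E. Qed.
Let cz : continuous z. Proof. exact: derive_continuous dz. Qed.
Let cw : continuous w. Proof. by case: E => _ _ _ dw _; exact: derive_continuous dw. Qed.
Let a0 : 0 < a. Proof. exact: mass_gt0. Qed.
Let an : a != 0. Proof. by rewrite gt_eqF. Qed.

Lemma elliptic_simple_zeros x : z x = 0 -> w x != 0.
Proof.
move=> zx; case: E => _ _ _ _ /(_ x); rewrite zx !expr0n/= !mulr0 !add0r => w2.
by rewrite -sqrf_eq0 w2 mulf_neq0 ?oner_eq0// invr_neq0// expf_neq0.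
Qed.

Lemma elliptic_order x : vanishes_to_order z x (z x == 0).
Proof.
have [zx|zx] := eqVneq (z x) 0.
  exact: vanishes_order1 (dz x) (elliptic_simple_zeros zx) zx.
by apply: vanishes_order0 => //; exact: cz.
Qed.

Lemma elliptic_isolated x : \forall y \near x^', z y != 0.
Proof. exact: vanishes_neq0 (elliptic_order x). Qed.

Lemma elliptic_zeros_finite : finite_set (zeros z).
Proof. exact: circle_zeros_finite elliptic_isolated. Qed.

Let cz2 : continuous (fun x => z x ^+ 2). Proof. exact: continuous_exp. Qed.
Let pz2 : periodic (fun x => z x ^+ 2) 1. Proof. by move=> x; rewrite pz. Qed.

Lemma time_change_der x : is_derive x (1 : R) T (z x ^+ 2 / a).
Proof.
rewrite mulrC; have := isder_scale a^-1 (sint_primitive cz2 x).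
by congr is_derive; apply/funext => y; rewrite mulrC.
Qed.

Lemma time_change_lift : circle_lift T S.
Proof.
apply: continuous_lift.
- exact: derive_continuous time_change_der.
- apply: (@punctured_increasing _ _ (fun x => z x ^+ 2 / a)).
    exact: derive_continuous time_change_der.
  move=> x; apply: filterS (elliptic_isolated x) => y zy; split; first exact: time_change_der.
  by rewrite divr_gt0// lt_neqAle sqr_ge0 andbT eq_sym sqrf_eq0.
- move=> x; rewrite /time_change -(@sint_chasles _ _ 0 x (x + 1));
  last exact: loc_int_continuous.
  rewrite sint_period//; [|exact: continuous_measurable_fun|exact: loc_int_continuous].
  by rewrite mean_sint -massE mulrDl divff.
- by rewrite /time_change sintxx mul0r.
Qed.

Let L := time_change_lift.
Let LV := lift_inv L.
Let cS : continuous S. Proof. by have [] := L. Qed.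

Lemma levi_civita_ge0 t : 0 <= q t. Proof. exact: sqr_ge0. Qed.

Lemma levi_civita_neq0 t : (q t != 0) = (z (S t) != 0).
Proof. by rewrite /levi_civita1 sqrf_eq0. Qed.

Lemma levi_civita_isolated t : \forall y \near t^', q y != 0.
Proof.
have : \forall y \near t^', z (S y) != 0.
  by apply: (lift_dnbhs (P := fun y => z y != 0) LV); exact: elliptic_isolated.
by apply: filterS => y; rewrite levi_civita_neq0.
Qed.

Lemma levi_civita_periodic : periodic q 1.
Proof. by move=> t; rewrite /levi_civita1 (lift_shift LV) pz. Qed.

Lemma levi_civita_continuous : continuous q.
Proof.
apply: continuous_exp => t; apply: (@continuous_comp _ _ _ S z); [exact: cS|exact: cz].
Qed.

Lemma time_change_inv_der t : q t != 0 -> is_derive t (1 : R) S (a / q t).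
Proof.
rewrite levi_civita_neq0 => zt.
have := lift_is_derive L (time_change_der (S t)).
rewrite (lift_bwd L) => H; apply: isder_eq (H _) _.
  by rewrite mulf_neq0 ?expf_neq0 ?invr_neq0.
by rewrite /levi_civita1 invfM invrK mulrC.
Qed.

(* As [x / 0 = 0], this vanishes at the collisions. *)
Let p t := 2 * a * (w (S t) / z (S t)).

Lemma levi_civita_kepler : kepler_motion c q p.
Proof.
move=> t qt; have := qt; rewrite levi_civita_neq0 => zt.
have DS := time_change_inv_der qt.
have Dz := isder_comp (dz (S t)) DS.
have [_ _ _ dw FI] := E; have Dw := isder_comp (dw (S t)) DS.
split.
  apply: isder_eq (isder_exp 2 Dz) _; rewrite /= /p /levi_civita1 expr1.
  by field; rewrite zt.
have := isder_scale (2 * a) (isder_mul Dw (isder_inv zt Dz)); move=> /isder_eq; apply.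
rewrite /levi_civita1.
(* Brought to a form where the first integral eliminates [w ^+ 2]: its constant [1 / a ^+ 2] becomes
   the attraction, and half of the quartic term remains as [1 / c ^+ 2]. *)
have -> : 2 * a * ((A * z (S t) + 1 / (a ^+ 2 * c ^+ 2) * z (S t) ^+ 3) * (a / z (S t) ^+ 2) /
  z (S t) +
  w (S t) * (- (w (S t) * (a / z (S t) ^+ 2)) / z (S t) ^+ 2)) =
  2 * a ^+ 2 * (A * z (S t) ^+ 2 + 1 / (a ^+ 2 * c ^+ 2) * z (S t) ^+ 4 - w (S t) ^+ 2) / z (S
    t) ^+ 4.
  by field; rewrite zt an c0.
by rewrite FI; field; rewrite zt an c0.
Qed.

Lemma levi_civita_energy t : q t != 0 -> energy c q t = 2 * a ^+ 2 * A.
Proof.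
move=> qt; have := qt; rewrite levi_civita_neq0 => zt.
rewrite /energy (isder_derive1 (levi_civita_kepler qt).1) /p /levi_civita1.
have [_ _ _ _ FI] := E.
have -> : (2 * a * (w (S t) / z (S t))) ^+ 2 / 2 = 2 * a ^+ 2 * w (S t) ^+ 2 / z (S t) ^+ 2.
  by field; rewrite zt.
by rewrite FI; field; rewrite zt an c0.
Qed.

(** [S / a] is continuous across the collisions and has derivative [1 / q] off them, so its
    increments bound the integrals. *)
Lemma inv_levi_civita_loc_int : loc_int (fun t => (q t)^-1).
Proof.
apply: (@punctured_loc_int _ (fun t => a^-1 * S t)).
- exact: continuous_scale.
- have -> : (fun t => (q t)^-1) = (fun x => x^-1) \o q by [].
  by apply: measurableT_comp measurable_invr _;
    exact: continuous_measurable_fun levi_civita_continuous.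
- by move=> t; rewrite invr_ge0 levi_civita_ge0.
- move=> t; apply: filterS (levi_civita_isolated t) => y qy; split.
    apply: (@continuousV _ _ q y) => //; exact: levi_civita_continuous.
  apply: isder_eq (isder_scale a^-1 (time_change_inv_der qy)) _.
  by rewrite mulrA mulVf// mul1r.
Qed.

Lemma time_change_inv_sint t : S t = a * sint 0 t (fun t => (q t)^-1).
Proof.
have H : S t - S 0 = sint 0 t (fun t => a * (q t)^-1).
  apply: punctured_FTC => //; first exact: loc_intZ inv_levi_civita_loc_int.
  move=> x; apply: filterS (levi_civita_isolated x) => y qy; split;
    last exact: time_change_inv_der.
  apply: cvgMr; apply: (@continuousV _ _ q y) => //; exact: levi_civita_continuous.
by rewrite -sintZ; [rewrite -H (lift_zero LV) subr0|exact: inv_levi_civita_loc_int].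
Qed.

(** The substitution [t = T x], performed by exhibiting a continuous primitive of [q] off the
    collisions. *)
Lemma mean_levi_civita : mean q = quart z / a.
Proof.
pose F t := a^-1 * sint 0 (S t) (fun x => z x ^+ 4).
have cz4 : continuous (fun x => z x ^+ 4) by exact: continuous_exp.
have dF := sint_primitive cz4.
have H : F 1 - F 0 = sint 0 1 q.
  apply: punctured_FTC.
  - apply: continuous_scale => t.
    apply: (@continuous_comp _ _ _ S (fun y => sint 0 y (fun x => z x ^+ 4))); first exact: cS.
    exact: (derive_continuous dF).
  - exact: loc_int_continuous levi_civita_continuous.
  - move=> x; apply: filterS (levi_civita_isolated x) => y qy; split;
    first exact: levi_civita_continuous.
    have := isder_scale a^-1 (isder_comp (dF (S y)) (time_change_inv_der qy)).
    move=> /isder_eq; apply; move: qy; rewrite levi_civita_neq0 => zy.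
    by rewrite /levi_civita1; field; rewrite zy an.
have S1 : S 1 = 1 by have := lift_shift LV 0; rewrite !add0r (lift_zero LV) add0r.
by rewrite mean_sint -H /F S1 (lift_zero LV) sintxx mulr0 subr0 mulrC -quartE.
Qed.

(** The velocity blows up at the collisions, but by conservation of energy its square grows only
    like [4 / q], which is integrable. *)
Lemma levi_civita_weak_derivative : is_weak_derivative q p.
Proof.
have mS : measurable_fun setT S by exact: continuous_measurable_fun.
have mp : measurable_fun setT p.
  apply: measurable_funM; first exact: measurable_cst.
  apply: measurable_funM.
    by apply: continuous_measurable_fun => t; apply: (@continuous_comp _ _ _ S w);
      [exact: cS|exact: cw].
  apply: (measurableT_comp measurable_invr).
  by apply: continuous_measurable_fun => t; apply: (@continuous_comp _ _ _ S z);
    [exact: cS|exact: cz].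
have pp : periodic p 1.
  move=> t; rewrite /p (lift_shift LV) pz.
  have [Lw _] : is_weak_derivative z w by exact: C1_weak_derivative pz cw dz.
  by case: Lw => pw _ _; rewrite pw.
have cq := levi_civita_continuous; have iq := inv_levi_civita_loc_int.
have ip2 : loc_int (fun t => p t ^+ 2).
  (* The absolute value keeps the bound nonnegative at the collisions, where [p] and [1 / q] are 0
     by convention. *)
  apply: (@loc_int_le _ _ (fun t => `|4 * a ^+ 2 * A| + (4 * (q t)^-1 + 2 / c ^+ 2 * q t))).
  - exact: measurable_sqr.
  - apply: loc_intD; first by apply: loc_int_continuous; exact: continuous_cst.
    apply: loc_intD; first exact: loc_intZ.
    by apply: loc_intZ; exact: loc_int_continuous.
  move=> t; rewrite ger0_norm ?sqr_ge0//.
  have q0 := levi_civita_ge0 t.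
  have qi0 : 0 <= (q t)^-1 by rewrite invr_ge0.
  have c2 : 0 <= c ^- 2 by rewrite invr_ge0 sqr_ge0.
  have [qt|qt] := eqVneq (q t) 0.
    have -> : p t = 0.
      by move/eqP: qt; rewrite /p /levi_civita1 sqrf_eq0 => /eqP ->; rewrite invr0 !mulr0.
    by rewrite qt invr0 !mulr0 !addr0 expr0n/= normr_ge0.
  have := levi_civita_energy qt;
    rewrite /energy (isder_derive1 (levi_civita_kepler qt).1) => En.
  have -> : p t ^+ 2 = 4 * a ^+ 2 * A + (4 * (q t)^-1 + 2 / c ^+ 2 * q t).
    have -> : 4 * a ^+ 2 * A = 2 * (2 * a ^+ 2 * A) by ring.
    by rewrite -En; field; rewrite qt c0.
  by rewrite lerD2r ler_norm.
have L2p : L2_circle p by split=> //; exact: (ip2 0 1).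
split=> // x y; apply: punctured_FTC => //; first exact: L2_loc_int.
move=> t; apply: filterS (levi_civita_isolated t) => u qu.
have [D1 D2] := levi_civita_kepler qu; split=> //; exact: isder_continuous D2.
Qed.

Lemma levi_civita_zeros : zeros q = T @` zeros z.
Proof.
apply/seteqP; split => [t [t01 qt]|_ [x [x01 zx] <-]].
  exists (S t); last by rewrite (lift_bwd L).
  split; first by rewrite -(lift_itv _ L) (lift_bwd L).
  by apply/eqP; move/eqP: qt; rewrite /levi_civita1 sqrf_eq0.
split; first by rewrite (lift_itv _ L).
by rewrite /levi_civita1 (lift_fwd L) zx expr0n.
Qed.

Lemma levi_civita_zeros_even : exists n, zeros q #= `I_n.*2.
Proof.
have [n zn] := elliptic_zeros_finite; have [s us [sn sz]] := finite_set_enum zn.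
have en : ~~ odd n by rewrite -sn; exact: even_simple_zeros pz dz elliptic_simple_zeros us sz.
exists n./2; have -> : n./2.*2 = n by rewrite -[RHS]odd_double_half (negbTE en).
rewrite levi_civita_zeros; apply: card_eq_trans zn.
by apply: inj_card_eq => x y _ _; exact: (can_inj (lift_fwd L)).
Qed.

Lemma levi_civita_generalized_solution : generalized_solution1 c q.
Proof.
split.
- by split; [exact: levi_civita_periodic|exists p; exact: levi_civita_weak_derivative].
- exact: levi_civita_ge0.
- exact: levi_civita_zeros_even.
- exact: kepler_motion_solves levi_civita_continuous levi_civita_kepler.
- exists (fun=> 2 * a ^+ 2 * A); split => //.
    exact: continuous_cst.
  by move=> t qt; rewrite levi_civita_energy.
Qed.

End Forward.

(** * Uniqueness up to sign *)

Section Uniqueness.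
Context {R : realType}.
Implicit Types (u v w z : R -> R) (c A x t : R).

(** The product [z1 * z2] has order 0 or 2 at every point, hence constant sign; this makes the
    pointwise choice in [z2 = z1] or [z2 = - z1] global. *)
Lemma same_square_same_simple_zeros z1 z2 (c1 c2 A1 A2 : R) w1 w2 :
  elliptic c1 A1 z1 w1 -> elliptic c2 A2 z2 w2 ->
  (forall x, z1 x ^+ 2 = z2 x ^+ 2) -> z2 = z1 \/ z2 = (fun x => - z1 x).
Proof.
move=> E1 E2 H.
have c1z : continuous z1 by case: E1 => _ _ d _ _; exact: derive_continuous d.
have c2z : continuous z2 by case: E2 => _ _ d _ _; exact: derive_continuous d.
have zz x : (z1 x == 0) = (z2 x == 0) by rewrite -sqrf_eq0 H sqrf_eq0.
pose g x := z1 x * z2 x.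
have og x : vanishes_to_order g x ((z1 x == 0) + (z1 x == 0)).
  apply: vanishes_mul; first exact: elliptic_order E1 x.
  rewrite zz; exact: elliptic_order E2 x.
have ng x : ~~ odd ((z1 x == 0) + (z1 x == 0)) by rewrite oddD addbb.
have cg : continuous g by exact: continuous_mul.
have [P|P] := even_order_sign og ng; [left|right]; apply/funext => x.
- have := dnbhs_gt0_ge0 cg P x; rewrite /g => g0.
  have /eqP := H x; rewrite eqf_sqr => /orP[/eqP->//|/eqP E].
  move: g0; rewrite E mulNr oppr_ge0 -expr2 => g0.
  have : z2 x ^+ 2 == 0 by rewrite eq_le g0 sqr_ge0.
  by rewrite sqrf_eq0 => /eqP ->; rewrite oppr0.
- have cg' : continuous (\- g) by move=> y; apply: cvgN; exact: cg.
  have P' y : \forall u \near y^', 0 < (\- g) u by apply: filterS (P y) => u; rewrite oppr_gt0.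
  have := dnbhs_gt0_ge0 cg' P' x; rewrite /g /= => g0.
  have /eqP := H x; rewrite eqf_sqr => /orP[/eqP E|/eqP->]; last by rewrite opprK.
  move: g0; rewrite E oppr_ge0 -expr2 => g0.
  have : z2 x ^+ 2 == 0 by rewrite eq_le g0 sqr_ge0.
  by rewrite sqrf_eq0 => /eqP ->; rewrite oppr0.
Qed.

(** The inverse time change is [mass z] times the primitive of [1 / q], and its value 1 at time 1
    determines the mass. So [q] determines the time change, and with it [z ^+ 2]. *)
Lemma levi_civita1_inj z1 z2 (c A1 A2 : R) w1 w2 : c != 0 ->
  elliptic c A1 z1 w1 -> elliptic c A2 z2 w2 ->
  levi_civita1 z1 = levi_civita1 z2 -> z2 = z1 \/ z2 = (fun x => - z1 x).
Proof.
move=> c0 E1 E2 H; apply: (same_square_same_simple_zeros E1 E2) => x.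
have L1 := time_change_lift E1; have L2 := time_change_lift E2.
have S1 t := time_change_inv_sint E1 t; have S2 t := time_change_inv_sint E2 t.
have one G K : circle_lift (R := R) G K -> K 1 = 1.
  by move=> /lift_inv L; have := lift_shift L 0; rewrite !add0r (lift_zero L) add0r.
have aE : mass z1 = mass z2.
  have := one _ _ L1; have := one _ _ L2; rewrite S1 S2 H => e2 e1.
  have i0 : sint 0 1 (fun t => (levi_civita1 z2 t)^-1) != 0.
    by apply/eqP => i0; move: e2; rewrite i0 mulr0 => /eqP; rewrite eq_sym oner_eq0.
  by apply: (mulIf i0); rewrite e1 e2.
have SE : time_change_inv z1 = time_change_inv z2.
  by apply/funext => t; rewrite S1 S2 H aE.
have := congr1 (fun f => f (time_change z1 x)) H.
by rewrite /levi_civita1 -SE (lift_fwd L1).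
Qed.

Lemma levi_civita1N z : levi_civita1 (fun x => - z x) = levi_civita1 z.
Proof.
have TE : time_change (fun x => - z x) = time_change z.
  apply/funext => x; rewrite /time_change norm2N; congr (_ / _).
  by congr sint; apply/funext => y; rewrite sqrrN.
by apply/funext => t; rewrite /levi_civita1 /time_change_inv TE sqrrN.
Qed.

End Uniqueness.

(** * From generalized solutions to critical points *)

Section PuncturedRegularity.
Context {R : realType}.
Implicit Types (f g F : R -> R) (x y : R).

Lemma continuous_of_sqr f g x : (forall y, f y ^+ 2 = g y) -> {for x, continuous g} -> g x = 0
  ->
  {for x, continuous f}.
Proof.
move=> fg cg gx; have fx : f x = 0 by apply/eqP; rewrite -sqrf_eq0 fg gx.
apply/cvgrPdist_lt => e e0; rewrite fx.
have e2 : g x < e ^+ 2 by rewrite gx exprn_gt0.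
apply: filterS (cvgr_lt _ cg _ e2) => y; rewrite -fg sub0r normrN.
rewrite -(real_normK (num_real (f y))) => H.
by rewrite -(ltr_pXn2r (n := 2))// nnegrE// ltW.
Qed.

(** With [f] continuous, [F] is its primitive up to a constant, so the formula for the derivative
    extends across the exceptional points. *)
Lemma punctured_is_derive F f : continuous F -> continuous f ->
  (forall x, \forall y \near x^', is_derive y (1 : R) F (f y)) ->
  forall x, is_derive x (1 : R) F (f x).
Proof.
move=> cF cf H x.
have FE : F = fun y => F 0 + sint 0 y f.
  apply/funext => y; rewrite -(punctured_FTC cF (loc_int_continuous cf)); first by ring.
  by move=> u; apply: filterS (H u) => v dv; split => //; exact: cf.
by rewrite FE; apply: isder_eq (isder_add (isder_cst _ x) (sint_primitive cf x)) _;
  rewrite add0r.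
Qed.

End PuncturedRegularity.

(** * Regularization of a generalized solution *)

Section Backward.
Context {R : realType}.
Variables (c : R) (q : R -> R).
Hypotheses (c0 : c != 0) (GS : generalized_solution1 c q).

Let p := derive1 q.
Let cq : continuous q. Proof. by case: GS => Hq _ _ _ _; exact: H1_continuous. Qed.
Let pq : periodic q 1. Proof. by case: GS => -[]. Qed.
Let q0 t : 0 <= q t. Proof. by case: GS. Qed.
Let K : kepler_motion c q p. Proof. by case: GS => _ _ _ H _; exact: solves_kepler_motion. Qed.
Let iso x : \forall y \near x^', q y != 0.
Proof.
case: GS => _ _ [n Hn] _ _; apply: circle_zeros_isolated => //.
by exists n.*2.
Qed.
Let near_neq0 t : q t != 0 -> \forall y \near t, q y != 0.
Proof. by apply: open_nonzero; exact: cq. Qed.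

(** The extended energy has zero derivative off the collisions and, being continuous, cannot jump at
    one. *)
Lemma generalized_energy_constant : exists e, forall t, q t != 0 ->
  p t ^+ 2 = 2 * e + 4 / q t + 2 * q t / c ^+ 2.
Proof.
case: GS => _ _ _ _ [E [pE cE EE]]; exists (E 0) => t qt.
suff H x y : E x = E y.
  have := EE t qt; rewrite -(H 0 t) /energy -/p => ->.
  by field; rewrite qt c0.
apply: punctured_constant => // u; apply: filterS (iso u) => v qv.
have [dq dp] := K qv.
have D : is_derive v (1 : R) (energy c q) 0.
  have := isder_sub (isder_sub (isder_scale (2^-1) (isder_exp 2 dp)) (isder_scale 2 (isder_inv
    qv dq))) (isder_scale (c ^- 2) dq).
  move=> /isder_eq H.
  have : is_derive v (1 : R) (fun y => 2^-1 * p y ^+ 2 - 2 * (q y)^-1 - c ^- 2 * q y) 0.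
    by apply: H; rewrite /=; field; rewrite qv c0.
  congr is_derive; apply/funext => s; rewrite /energy -/p; congr (_ - _ - _); exact: mulrC.
by apply: isder_near_eq D _; apply: filterS (near_neq0 qv) => s qs; rewrite EE.
Qed.

Let qp t := q t * p t.

Let qp_sqr e : (forall t, q t != 0 -> p t ^+ 2 = 2 * e + 4 / q t + 2 * q t / c ^+ 2) ->
  forall t, qp t ^+ 2 = q t * (4 + 2 * e * q t + 2 / c ^+ 2 * q t ^+ 2).
Proof.
move=> H t; rewrite /qp; have [->|qt] := eqVneq (q t) 0; first by rewrite !mul0r expr0n.
by rewrite exprMn H//; field; rewrite qt c0.
Qed.

Let continuous_quad (f : R -> R) (k0 k1 k2 : R) : continuous f -> continuous (fun t => k0 + k1
  * f t + k2 * f t ^+ 2).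
Proof.
move=> cf; apply: (@continuous_add _ (fun t => k0 + k1 * f t) (fun t => k2 * f t ^+ 2)).
  by apply: (@continuous_add _ (fun=> k0) (fun t => k1 * f t));
    [exact: continuous_cst|exact: continuous_scale].
by apply: continuous_scale; exact: continuous_exp.
Qed.

(** By conservation of energy the square of [q q'] is [q] times a continuous function, so it tends
    to 0 at a collision. *)
Lemma generalized_momentum_continuous : continuous qp.
Proof.
have [e He] := generalized_energy_constant.
move=> t; have [qt|qt] := eqVneq (q t) 0.
  apply: (continuous_of_sqr (qp_sqr He)); last by rewrite qt mul0r.
  have cm : continuous (fun t => 4 + 2 * e * q t + 2 / c ^+ 2 * q t ^+ 2) by exact:
    continuous_quad.
  exact: (continuous_mul cq cm).
have [dq dp] := K qt.
by apply: cvgM; [exact: cq|exact: isder_continuous dp].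
Qed.

Let dqp e : (forall t, q t != 0 -> p t ^+ 2 = 2 * e + 4 / q t + 2 * q t / c ^+ 2) ->
  forall t, q t != 0 -> is_derive t (1 : R) qp (2 / q t + (2 * e + 3 / c ^+ 2 * q t)).
Proof.
move=> He t qt; have [dq dp] := K qt.
have := isder_mul dq dp => /isder_eq; apply.
by rewrite -expr2 He//; field; rewrite qt c0.
Qed.

(* [2 / q] is, off the collisions, the derivative of [q q' - int (2 e + 3 q / c^2)]. *)
Lemma generalized_inv_loc_int : loc_int (fun t => (q t)^-1).
Proof.
have [e He] := generalized_energy_constant.
have cl : continuous (fun t => 2 * e + 3 / c ^+ 2 * q t).
  by apply: (@continuous_add _ (fun=> 2 * e) (fun t => 3 / c ^+ 2 * q t));
    [exact: continuous_cst|exact: continuous_scale].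
have mqi : measurable_fun setT (fun t => (q t)^-1).
  by apply: (measurableT_comp measurable_invr); exact: continuous_measurable_fun.
have H : loc_int (fun t => 2 * (q t)^-1).
  apply: (@punctured_loc_int _ (fun t => qp t - sint 0 t (fun t => 2 * e + 3 / c ^+ 2 * q t))).
  - apply: continuous_sub; first exact: generalized_momentum_continuous.
    exact: derive_continuous (sint_primitive cl).
  - by apply: measurable_funM => //; exact: measurable_cst.
  - by move=> t; rewrite mulr_ge0 ?invr_ge0.
  - move=> t; apply: filterS (iso t) => y qy; split.
      by apply: cvgMr; apply: (@continuousV _ _ q y) => //; exact: cq.
    have := isder_sub (dqp He qy) (sint_primitive cl y) => /isder_eq; apply; ring.
have := loc_intZ 2^-1 H; congr loc_int; apply/funext => t.
by rewrite mulrA mulVf ?mul1r// pnatr_eq0.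
Qed.

Let I t := sint 0 t (fun t => (q t)^-1).
Let cI : continuous I. Proof. exact: sint_continuous generalized_inv_loc_int. Qed.
Let dI t : q t != 0 -> is_derive t (1 : R) I (q t)^-1.
Proof.
move=> qt; apply: (@sint_is_derive _ (fun t => (q t)^-1)); first exact: generalized_inv_loc_int.
by apply: (@continuousV _ _ q t) => //; exact: cq.
Qed.

Let I_incr x y : x < y -> I x < I y.
Proof.
move: x y; apply: (@punctured_increasing _ _ (fun t => (q t)^-1)) => //.
move=> x; apply: filterS (iso x) => y qy; split; first exact: dI.
by rewrite invr_gt0 lt_neqAle eq_sym qy q0.
Qed.

Let I0 : I 0 = 0. Proof. exact: sintxx. Qed.
Let I1 : 0 < I 1. Proof. by rewrite -I0 I_incr. Qed.
(** Normalized so that [S 1 = 1]; it turns out to be the mass of the [z] to be constructed. *)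
Let a := (I 1)^-1.
Let a0 : 0 < a. Proof. by rewrite invr_gt0. Qed.
Let an : a != 0. Proof. by rewrite gt_eqF. Qed.
Let S t := a * I t.
Let T := pinv setT S.

Let L : circle_lift S T.
Proof.
apply: continuous_lift.
- exact: continuous_scale.
- by move=> x y xy; rewrite ltr_pM2l// I_incr.
- move=> x; rewrite /S /I -(@sint_chasles _ _ 0 x (x + 1)); last exact: generalized_inv_loc_int.
  rewrite sint_period.
  + by rewrite mulrDr mean_sint -/(I 1) mulVf// gt_eqF.
  + by move=> t; rewrite pq.
  + by apply: (measurableT_comp measurable_invr); exact: continuous_measurable_fun.
  + exact: generalized_inv_loc_int.
- by rewrite /S I0 mulr0.
Qed.
Let LV := lift_inv L.
Let cT : continuous T. Proof. by have [] := LV. Qed.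

Let y x := q (T x).
Let cy : continuous y. Proof. by move=> x; apply: (@continuous_comp _ _ _ T q);
  [exact: cT|exact: cq]. Qed.
Let py : periodic y 1. Proof. by move=> x; rewrite /y (lift_shift LV) pq. Qed.
Let y0 x : 0 <= y x. Proof. exact: q0. Qed.
Let isoy x : \forall u \near x^', y u != 0.
Proof. by apply: (lift_dnbhs (P := fun t => q t != 0) LV); exact: iso. Qed.

Let dT x : y x != 0 -> is_derive x (1 : R) T (y x / a).
Proof.
move=> yx; have := lift_is_derive L (isder_scale a (dI yx)).
rewrite (lift_bwd L) => H; apply: isder_eq (H _) _; first by rewrite mulf_neq0// invr_neq0.
by rewrite invf_div.
Qed.

(** The derivative of [y], that is [q'] times [T' = q / a], in the form that is continuous across
    the collisions. *)
Let Y1 x := qp (T x) / a.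
Let cY1 : continuous Y1.
Proof.
have := continuous_scale (k := a^-1) (f := fun x => qp (T x)).
rewrite /Y1; under [in X in _ -> X]eq_fun do rewrite mulrC.
apply => x; apply: (@continuous_comp _ _ _ T qp); first exact: cT.
exact: generalized_momentum_continuous.
Qed.

Let dy x : is_derive x (1 : R) y (Y1 x).
Proof.
move: x; apply: punctured_is_derive => // x; apply: filterS (isoy x) => u yu.
have := isder_comp (K yu).1 (dT yu) => /isder_eq; apply.
by rewrite /Y1 /qp /y; field.
Qed.

(** [sqrt y] has a corner at each zero of [y]. The sign of [sinpi_prod s] flips there and removes
    it, and since [size s] is even the product keeps the period 1. The coefficient
    [e / (2 * a ^+ 2)] inverts the relation of [levi_civita_energy]. *)
Lemma square_root_exists e (s : seq R) :
  (forall t, q t != 0 -> p t ^+ 2 = 2 * e + 4 / q t + 2 * q t / c ^+ 2) ->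
  uniq s -> ~~ odd (size s) -> zeros y = [set` s] ->
  exists z w, [/\ periodic z 1, forall x, z x ^+ 2 = y x,
      forall x, is_derive x (1 : R) z (w x),
      forall x, is_derive x (1 : R) w (e / (2 * a ^+ 2) * z x + 1 / (a ^+ 2 * c ^+ 2) * z x ^+
        3) &
      forall x, w x ^+ 2 = e / (2 * a ^+ 2) * z x ^+ 2 + 1 / (2 * a ^+ 2 * c ^+ 2) * z x ^+ 4
        + 1 / a ^+ 2].
Proof.
move=> He us es ys.
(* The regular factor in the energy identity [Y1 ^+ 2 = y * m / a ^+ 2]; it equals 4 at the zeros of
   [y]. *)
pose m x := 4 + 2 * e * y x + 2 / c ^+ 2 * y x ^+ 2.
have cm : continuous m by exact: continuous_quad.
have Y1_sqr x : Y1 x ^+ 2 = y x * m x / a ^+ 2 by rewrite /Y1 expr_div_n (qp_sqr He).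
pose Y2 x := (2 + 2 * e * y x + 3 / c ^+ 2 * y x ^+ 2) / a ^+ 2.
have cY2 : continuous Y2.
  rewrite /Y2; under eq_fun do rewrite mulrC.
  by apply: continuous_scale; exact: continuous_quad.
have dY1 x : is_derive x (1 : R) Y1 (Y2 x).
  move: x; apply: punctured_is_derive => // x; apply: filterS (isoy x) => u yu.
  have := isder_scale a^-1 (isder_comp (dqp He yu) (dT yu)).
  have -> : (fun x => a^-1 * qp (T x)) = Y1 by apply/funext => v; rewrite /Y1 mulrC.
  by move=> /isder_eq; apply; rewrite /Y2 /y; field; rewrite yu c0 an.
have s01 t : t \in s -> 0 <= t < 1.
  by move=> ts; have [] : zeros y t by rewrite ys.
have ysx x : (y x == 0) = (circle_frac x \in s).
  apply/eqP/idP => [yx|xs].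
    by have : zeros y (circle_frac x); [split;
      [exact: circle_frac_itv|rewrite periodic_circle_frac]|rewrite ys].
  have [_] : zeros y (circle_frac x) by rewrite ys.
  by rewrite periodic_circle_frac.
pose P := sinpi_prod s.
have oP x : vanishes_to_order P x (y x == 0) by rewrite ysx; exact: sinpi_prod_orderE.
have cP : continuous P by move=> x; exact: vanishes_continuous (oP x).
have P0 x : y x != 0 -> P x != 0.
  move=> /negbTE yx; have := oP x; rewrite yx => -[k [_ k0 ->]].
  by rewrite expr0 mulr1.
have pP : periodic P 1 by move=> x; rewrite /P sinpi_prod_period -signr_odd (negbTE es) mul1r.
pose z x := Num.sg (P x) * Num.sqrt (y x).
have z2 x : z x ^+ 2 = y x.
  rewrite /z exprMn sqr_sqrtr// sqr_sg; have [->|/P0->] := eqVneq (y x) 0;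
    last by rewrite mul1r.
  by rewrite mulr0.
have zy0 x : (z x == 0) = (y x == 0) by rewrite -sqrf_eq0 z2.
pose wt x := Y1 x / (2 * z x).
have wt2 x : y x != 0 -> wt x ^+ 2 = m x / (4 * a ^+ 2).
  move=> yx; rewrite /wt expr_div_n [(2 * z x) ^+ 2]exprMn z2 Y1_sqr.
  by field; rewrite yx an.
have m0 x : y x = 0 -> m x = 4 by move=> yx; rewrite /m yx expr0n/=; ring.
(* [w] is [wt] off the zeros of [y]. At a zero, [Y1] and [z] change sign together, so [sg * wt] is
   nonnegative on both sides and equals the square root of [wt ^+ 2]; hence the single limit
   [sg / a]. *)
have wlim x : exists l, (y x != 0 -> l = wt x) /\ (y x = 0 -> exists2 sg, sg = 1 \/ sg = -1 &
    l = sg / a /\ \forall u \near x^', wt u = sg * Num.sqrt (m u / (4 * a ^+ 2))).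
  have [yx|yx] := eqVneq (y x) 0; last by exists (wt x); split=> // /eqP; rewrite (negbTE yx).
  have [sg sgP Hsg] := vanishes_sign (oP x).
  exists (sg / a); split; first by [].
  move=> _; exists sg => //; split => //.
  have Y1x : Y1 x = 0 by apply/eqP; rewrite -sqrf_eq0 Y1_sqr yx !mul0r.
  (* [Y1] crosses zero upwards, with slope [2 / a ^+ 2]. *)
  have Y1pos : \forall u \near x^', 0 < (u - x) * Y1 u.
    have := dY1 x => /is_derive1_caratheodory[k [kE ck kx]].
    have k0 : 0 < k x.
      by rewrite kx /Y2 yx expr0n/= !mulr0 !addr0 divr_gt0// exprn_gt0.
    apply: filterS2 (nbhs_dnbhs (cvgr_gt _ ck _ k0)) (nbhs_dnbhs_neq x) => u ku ux.
    have -> : Y1 u = k u * (u - x) by rewrite -kE Y1x subr0.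
    rewrite mulrCA -expr2 mulr_gt0// lt_neqAle sqr_ge0 andbT eq_sym sqrf_eq0 subr_eq0;
      exact: ux.
  have yx' : (y x == 0) = true by apply/eqP.
  apply: filterS3 Hsg Y1pos (isoy x) => u; rewrite yx' expr1 => h1 h2 yu.
  have yup : 0 < y u by rewrite lt_neqAle eq_sym yu y0.
  have sy : 0 < Num.sqrt (y u) by rewrite sqrtr_gt0.
  have wpos : 0 <= sg * wt u.
    have zpos : 0 < sg * (u - x) * z u.
      rewrite /z mulrA mulr_gt0//.
      have Pu : P u = Num.sg (P u) * `|P u| by exact: numEsg.
      have Pn : 0 < `|P u| by rewrite normr_gt0 P0.
      by move: h1; rewrite [X in _ * X]Pu mulrA (pmulr_lgt0 _ Pn).
    have -> : sg * wt u = (sg * (u - x) * z u) * ((u - x) * Y1 u) / (2 * y u * (u - x) ^+ 2).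
      have ux : u - x != 0 by apply/eqP => ux; move: h2; rewrite ux mul0r ltxx.
      by rewrite /wt -z2; field; rewrite ux zy0 yu.
    apply: divr_ge0; first by apply: mulr_ge0; exact: ltW.
    by apply: mulr_ge0; [apply: mulr_ge0|exact: sqr_ge0].
  rewrite -wt2// sqrtr_sqr.
  by case: sgP wpos => ->; rewrite ?mul1r ?mulN1r => wpos;
    [rewrite ger0_norm|rewrite ler0_norm ?opprK// -oppr_ge0].
have [w wP] := choice wlim.
have wE x : y x != 0 -> w x = wt x by case: (wP x).
have near_y x : y x != 0 -> \forall u \near x, y u != 0 by apply: open_nonzero; exact: cy.
have sg_const x : y x != 0 -> \forall u \near x, z u = Num.sg (P x) * Num.sqrt (y u).
  move=> yx; have Px := P0 x yx.
  have [Pp|Pn|/eqP] := ltgtP (P x) 0; last by rewrite (negbTE Px).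
    by apply: filterS (cvgr_lt _ (cP x) _ Pp) => u Pu; rewrite /z !ltr0_sg.
  by apply: filterS (cvgr_gt _ (cP x) _ Pn) => u Pu; rewrite /z !gtr0_sg.
have dz_off x : y x != 0 -> is_derive x (1 : R) z (w x).
  move=> yx; have yp : 0 < y x by rewrite lt_neqAle eq_sym yx y0.
  have D := isder_scale (Num.sg (P x)) (isder_comp (is_derive1_sqrt yp) (dy x)).
  have zx : z x = Num.sg (P x) * Num.sqrt (y x) by [].
  have D' : is_derive x (1 : R) z (Num.sg (P x) * ((2 * Num.sqrt (y x))^-1 * Y1 x)).
    by apply: isder_near_eq D _; apply: filterS (sg_const x yx) => u ->.
  apply: isder_eq D' _; rewrite wE// /wt zx.
  have sn : Num.sqrt (y x) != 0 by rewrite sqrtr_eq0 -ltNge.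
  have gn : Num.sg (P x) != 0 by rewrite sgr_eq0 P0.
  have g2 : Num.sg (P x) ^+ 2 = 1 by rewrite sqr_sg P0.
  (* The sign squares to 1, so multiplying by it amounts to dividing by it. *)
  rewrite [in LHS](_ : Num.sg (P x) = Num.sg (P x) ^+ 2 / Num.sg (P x)); last by field.
  by rewrite g2; field; rewrite gn sn.
have cz : continuous z.
  move=> x; have [yx|yx] := eqVneq (y x) 0; last exact: isder_continuous (dz_off x yx).
  by apply: (continuous_of_sqr z2) => //; exact: cy.
have cw : continuous w.
  move=> x; have [yx|yx] := eqVneq (y x) 0.
    have [_ /(_ yx)[sg sgP [wx Hw]]] := wP x.
    have csq : {for x, continuous (fun u => sg * Num.sqrt (m u / (4 * a ^+ 2)))}.
      apply: cvgMr; apply: (@continuous_comp _ _ _ (fun u => m u / (4 * a ^+ 2)) Num.sqrt);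
        last exact: sqrt_continuous.
      by apply: cvgMl; exact: cm.
    have Ex : w x = sg * Num.sqrt (m x / (4 * a ^+ 2)).
      rewrite wx m0//; have -> : 4 / (4 * a ^+ 2) = a^-1 ^+ 2 by field.
      by rewrite sqrtr_sqr ger0_norm// invr_ge0 ltW.
    have En : \forall u \near x, sg * Num.sqrt (m u / (4 * a ^+ 2)) = w u.
      have : \forall u \near x^', sg * Num.sqrt (m u / (4 * a ^+ 2)) = w u.
        by apply: filterS2 Hw (isoy x) => u <- yu; rewrite wE.
      rewrite /dnbhs /within /= => H; near=> u.
      have [->|ux] := eqVneq u x; first by rewrite Ex.
      by move: ux; near: u.
    rewrite /continuous_at Ex; apply: cvg_trans csq; exact: near_eq_cvg.
  have D : {for x, continuous wt}.
    apply: cvgM; first exact: cY1.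
    apply: (@continuousV _ _ (fun x => 2 * z x) x); first by rewrite mulf_neq0 ?pnatr_eq0// zy0.
    by apply: cvgMr; exact: cz.
  rewrite /continuous_at wE//; apply: cvg_trans D; apply: near_eq_cvg.
  by apply: filterS (near_y x yx) => u yu; rewrite wE.
have dz x : is_derive x (1 : R) z (w x).
  move: x; apply: punctured_is_derive => // x; apply: filterS (isoy x) => u; exact: dz_off.
have dw x : is_derive x (1 : R) w (e / (2 * a ^+ 2) * z x + 1 / (a ^+ 2 * c ^+ 2) * z x ^+ 3).
  move: x; apply: punctured_is_derive => //.
    apply: (@continuous_add _ (fun x => e / (2 * a ^+ 2) * z x)); first exact: continuous_scale.
    by apply: continuous_scale; exact: continuous_exp.
  move=> x; apply: filterS (isoy x) => u yu.
  have zu : z u != 0 by rewrite zy0.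
  have z2u : 2 * z u != 0 by rewrite mulf_neq0 ?pnatr_eq0.
  have D := isder_mul (dY1 u) (isder_inv (f := fun x => 2 * z x) z2u (isder_scale 2 (dz_off u
    yu))).
  have D' := isder_near_eq (g := w) D _.
  apply: isder_eq (D' _) _.
    by apply: filterS (near_y u yu) => v yv; rewrite wE.
  rewrite wE// /wt.
  have -> : Y2 u * (2 * z u)^-1 + Y1 u * (- (2 * (Y1 u / (2 * z u))) / (2 * z u) ^+ 2) =
    (Y2 u - Y1 u ^+ 2 / (2 * z u ^+ 2)) / (2 * z u) by field.
  by rewrite Y1_sqr /Y2 /m -!z2; field; rewrite zu an c0.
exists z, w; split=> //.
- by move=> x; rewrite /z pP py.
- move=> x; rewrite -[4%N]/(2 * 2)%N exprM z2.
  have [yx|yx] := eqVneq (y x) 0.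
    have [_ /(_ yx)[sg sgP [-> _]]] := wP x.
    rewrite yx expr0n/= !mulr0 !add0r expr_div_n.
    by case: sgP => ->; rewrite ?sqrrN expr1n.
  by rewrite wE// wt2// /m; field; rewrite an c0.
Unshelve. all: by end_near. Qed.

(** It remains to recognize [T] as the time change of [z]: [T' = y / a = z ^+ 2 / a], and [T 1 = 1]
    identifies [a] with [mass z]. *)
Lemma generalized_solution_levi_civita : exists A z w, elliptic c A z w /\ levi_civita1 z = q.
Proof.
have [e He] := generalized_energy_constant.
case: (GS) => _ _ [n Hn] _ _.
have yz : zeros y = S @` zeros q.
  apply/seteqP; split => [x [x01 yx]|_ [t [t01 qt] <-]].
    exists (T x); last by rewrite (lift_bwd L).
    by split; [rewrite (lift_itv _ LV)|].
  by split; [rewrite (lift_itv _ L)|rewrite /y (lift_fwd L)].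
have yn : zeros y #= `I_n.*2.
  rewrite yz; apply: card_eq_trans Hn; apply: inj_card_eq => t u _ _;
    exact: (can_inj (lift_fwd L)).
have [s us [sn sy]] := finite_set_enum yn.
have es : ~~ odd (size s) by rewrite sn odd_double.
have [z [w [pz z2 dz dw FI]]] := square_root_exists He us es sy.
have T1 : T 1 = 1 by have := lift_shift LV 0; rewrite !add0r (lift_zero LV) add0r.
have TE x : T x = sint 0 x y / a.
  have H : T x - T 0 = sint 0 x (fun x => a^-1 * y x).
    apply: punctured_FTC => //; first by apply: loc_intZ; exact: loc_int_continuous.
    move=> u; apply: filterS (isoy u) => v yv; split; first by apply: cvgMr; exact: cy.
    by apply: isder_eq (dT yv) _; rewrite mulrC.
  have iy : loc_int y by exact: loc_int_continuous.
  by move: H; rewrite (lift_zero LV) subr0 (@sintZ R a^-1 y 0 x iy) => ->; exact: mulrC.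
have mz : mass z = a.
  rewrite massE; under eq_fun do rewrite z2.
  by have := TE 1; rewrite T1 => /(congr1 (fun r => r * a)); rewrite mul1r divfK// => <-.
have nz : 0 < norm2 z.
  rewrite lt_neqAle norm2_ge0 andbT eq_sym; apply/eqP => nz.
  by move: mz a0; rewrite /mass nz expr0n/= => <-; rewrite ltxx.
have E : elliptic c (e / (2 * a ^+ 2)) z w.
  by split => // x; rewrite mz; [exact: dw|exact: FI].
exists (e / (2 * a ^+ 2)), z, w; split=> //.
have TzE : time_change z = T.
  apply/funext => x; rewrite /time_change -/(mass z) mz TE.
  by under eq_fun do rewrite z2.
have Lz := time_change_lift E.
apply/funext => t; rewrite /levi_civita1 z2 /y.
by have := lift_bwd Lz t; rewrite TzE => ->.
Qed.

(** [q] is positive off isolated points, so its primitive increases. This supplies [c != 0]. *)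
Lemma generalized_solution_mean_gt0 : 0 < mean q.
Proof.
rewrite mean_sint -[ltLHS](sintxx 0 q).
apply: (@punctured_increasing _ (fun t => sint 0 t q) q) => //.
  exact: derive_continuous (sint_primitive cq).
move=> x; apply: filterS (iso x) => u qu; split; first exact: sint_primitive.
by rewrite lt_neqAle eq_sym qu q0.
Qed.

End Backward.

(** * The correspondence *)

Section Correspondence.
Context {R : realType}.
Implicit Types (z q : pair_fun R) (c : R).

Lemma critical_elliptic z : critical_points z -> 0 < mean_sum z /\
  exists A1 w1 A2 w2, elliptic (mean_sum z) A1 z.1 w1 /\ elliptic (mean_sum z) A2 z.2 w2.
Proof.
move=> cz; have c0 := mean_sum_gt0 cz.1; split=> //.
have [[w1 E1] [w2 E2]] := (critical_pointsE z).1 cz.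
have cn : mean_sum z != 0 by rewrite gt_eqF.
have [A1 F1] := euler_lagrange_elliptic cn E1; have [A2 F2] := euler_lagrange_elliptic cn E2.
by exists A1, w1, A2, w2.
Qed.

Lemma elliptic_critical z A1 w1 A2 w2 : mean_sum z != 0 ->
  elliptic (mean_sum z) A1 z.1 w1 -> elliptic (mean_sum z) A2 z.2 w2 -> critical_points z.
Proof.
move=> cn E1 E2; apply/critical_pointsE; split;
  [exists w1; exact: elliptic_euler_lagrange cn E1|exists w2;
    exact: elliptic_euler_lagrange cn E2].
Qed.

Lemma critical_zeros_finite z : critical_points z ->
  finite_set (zeros z.1) /\ finite_set (zeros z.2).
Proof.
move=> /critical_elliptic[_ [A1 [w1 [A2 [w2 [E1 E2]]]]]].
by split; [exact: elliptic_zeros_finite E1|exact: elliptic_zeros_finite E2].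
Qed.

Lemma critical_mean_sum z : critical_points z ->
  mean (levi_civita z).1 + mean (levi_civita z).2 = mean_sum z.
Proof.
move=> /critical_elliptic[c0 [A1 [w1 [A2 [w2 [E1 E2]]]]]].
have cn : mean_sum z != 0 by rewrite gt_eqF.
by rewrite /= (mean_levi_civita E1) (mean_levi_civita E2).
Qed.

Lemma levi_civita_critical z : critical_points z -> generalized_solutions (levi_civita z).
Proof.
move=> cz; rewrite /generalized_solutions /= (critical_mean_sum cz).
have [c0 [A1 [w1 [A2 [w2 [E1 E2]]]]]] := critical_elliptic cz.
have cn : mean_sum z != 0 by rewrite gt_eqF.
by split; [exact: levi_civita_generalized_solution E1|exact: levi_civita_generalized_solution
  E2].
Qed.

(** With [c] read off from [q] the components are solved separately; that [c] is the [mean_sum] of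
    the resulting pair, as the Euler-Lagrange equations require, follows from [mean_levi_civita]. *)
Lemma generalized_solution_preimage q : generalized_solutions q ->
  exists z c A1 w1 A2 w2, [/\ c != 0, c = mean_sum z, levi_civita z = q,
    elliptic c A1 z.1 w1 & elliptic c A2 z.2 w2].
Proof.
move=> [G1 G2]; set c := mean q.1 + mean q.2 in G1 G2.
have c0 : 0 < c.
  rewrite addr_gt0//.
    exact: generalized_solution_mean_gt0 G1.
  exact: generalized_solution_mean_gt0 G2.
have cn : c != 0 by rewrite gt_eqF.
have [A1 [z1 [w1 [E1 L1]]]] := generalized_solution_levi_civita cn G1.
have [A2 [z2 [w2 [E2 L2]]]] := generalized_solution_levi_civita cn G2.
exists (z1, z2), c, A1, w1, A2, w2; split=> //.
  by rewrite /mean_sum /= -(mean_levi_civita E1) -(mean_levi_civita E2) L1 L2.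
by rewrite /levi_civita /= L1 L2; case: (q).
Qed.

Definition sign_fun (b : bool) (u : R -> R) : R -> R := if b then u else fun x => - u x.

Lemma sign_fun_inj b1 b2 u : 0 < norm2 u -> sign_fun b1 u = sign_fun b2 u -> b1 = b2.
Proof.
move=> u0; have nz : ~ (u = fun x => - u x).
  move=> H; have u00 : u = fun=> 0.
    by apply/funext => x; have := congr1 (fun f => f x) H => /= ?; lra.
  move: u0; rewrite /norm2 u00 dotE; under eq_fun do rewrite mul0r.
  by rewrite sint_cst mul0r sqrtr0 ltxx.
case: b1 b2 => -[]//= H; by exfalso; apply: nz.
Qed.

(** One preimage yields the others by changing the sign of either component: the equations and
    [mean_sum] are invariant under this, and uniqueness up to sign shows that nothing else
    occurs. *)
Lemma levi_civita_fiber q : generalized_solutions q ->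
  [set z | critical_points z /\ levi_civita z = q] #= `I_4.
Proof.
move=> /generalized_solution_preimage[z [c [A1 [w1 [A2 [w2 [cn cE Lz E1 E2]]]]]]].
pose f (b : bool * bool) : pair_fun R := (sign_fun b.1 z.1, sign_fun b.2 z.2).
have Esign b u A w : elliptic c A u w -> elliptic c A (sign_fun b u) (sign_fun b w).
  by case: b => //= E; exact: ellipticN.
have LC b u : levi_civita1 (sign_fun b u) = levi_civita1 u.
  by case: b => //=; exact: levi_civita1N.
have -> : [set z | critical_points z /\ levi_civita z = q] = f @` setT.
  apply/seteqP; split => [y [cy Ly]|_ [b _ <-]].
    have [c0 [B1 [v1 [B2 [v2 [F1 F2]]]]]] := critical_elliptic cy.
    (* Both pairs have the same [c] because it is the sum of the means of [q]. *)
    have yc : mean_sum y = c.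
      by rewrite -(critical_mean_sum cy) Ly -Lz /= (mean_levi_civita E1) (mean_levi_civita E2).
    rewrite yc in F1 F2.
    have H1 : levi_civita1 z.1 = levi_civita1 y.1 by have := congr1 fst Ly; rewrite -Lz.
    have H2 : levi_civita1 z.2 = levi_civita1 y.2 by have := congr1 snd Ly; rewrite -Lz.
    have sgn u v : v = u \/ v = (fun x => - u x) -> exists b, v = sign_fun b u.
      by case=> ->; [exists true|exists false].
    have [b1 e1] := sgn _ _ (levi_civita1_inj cn E1 F1 H1).
    have [b2 e2] := sgn _ _ (levi_civita1_inj cn E2 F2 H2).
    by exists (b1, b2) => //; rewrite /f /= -e1 -e2; case: (y).
  have mE : mean_sum (f b) = c.
    rewrite /mean_sum /= -(mean_levi_civita (Esign b.1 _ _ _ E1)) -(mean_levi_civita (Esign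
      b.2 _ _ _ E2)) !LC.
    by rewrite (mean_levi_civita E1) (mean_levi_civita E2).
  split; last by rewrite -Lz /levi_civita /f /= !LC.
  apply: (@elliptic_critical (f b) A1 (sign_fun b.1 w1) A2 (sign_fun b.2 w2)); rewrite mE//;
    exact: Esign.
have finj : injective f.
  move=> [b1 b2] [b1' b2'] [e1 e2]; congr (_, _).
    by apply: sign_fun_inj e1; case: E1.
  by apply: sign_fun_inj e2; case: E2.
(* The binary digits of [n] enumerate the pairs of signs. *)
pose g (n : nat) := (odd n, (1 < n)%N).
have -> : [set: bool * bool] = g @` `I_4.
  by apply/seteqP; split=> // -[[] []] _; [exists 3|exists 1|exists 2|exists 0].
apply: (card_eq_trans (B := g @` `I_4)); first by apply: inj_card_eq => ? ? _ _; exact: finj.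
apply: inj_card_eq => m n; rewrite !inE /g.
by case: m => [|[|[|[|m]]]]; case: n => [|[|[|[|n]]]].
Qed.

End Correspondence.

(** The finiteness of the zero sets ensures that [time_change] lifts a homeomorphism at every
    critical point, so that [levi_civita] is the intended transformation there and not a default
    value of the pseudo-inverse. *)
Theorem theorem1 (R : realType) :
  [/\ forall z : pair_fun R, critical_points z ->
        finite_set (zeros z.1) /\ finite_set (zeros z.2),
      set_fun critical_points generalized_solutions (@levi_civita R),
      set_surj critical_points generalized_solutions (@levi_civita R) &
      forall q : pair_fun R, generalized_solutions q ->
        [set z | critical_points z /\ levi_civita z = q] #= `I_4].
Proof.
split.
- exact: critical_zeros_finite.
- exact: levi_civita_critical.
- move=> q /generalized_solution_preimage[z [c [A1 [w1 [A2 [w2 [cn cE Lz E1 E2]]]]]]].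
  by exists z => //; apply: elliptic_critical; rewrite -cE; eassumption.
- exact: levi_civita_fiber.
Qed.
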